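(* Let $S$ be a rectangular domain. (a) Let $\ell_1\prec\ell_2\prec\cdots\prec\ell_n$ be elements of $C(S)$ and let $w_1,\dots,w_n>0$. Then there is a unique flow field $\bar\eta$ on $\mathbb{E}(\bar S)$ such that, for every $\ell\in C(S)$, $w_\eta(\ell)=w_j$ if $\ell=\ell_j$ for some $j$, and $w_\eta(\ell)=0$ otherwise. (b) Conversely, let $\bar\eta$ be any flow field on $\mathbb{E}(\bar S)$. Then the set $\{\ell\in C(S):w_\eta(\ell)>0\}$ is totally ordered by $\succeq$. Write it as $\ell_1\prec\cdots\prec\ell_n$ and put $w_j=w_\eta(\ell_j)$; these are the unique data for which the characterization in (a) holds. Moreover the following decompositions hold: $$\eta(e)=\sum_j w_j\,\mathbf{1}_{\{e\text{ is an edge of }\ell_j\}}\quad (e\in\mathbb{E}(\bar S)),\qquad \xi_y=\sum_j w_j\,\mathbf{1}_{L(\ell_j)}(y)\quad(y\in S),$$ $$\zeta^\pm_y=\sum_j w_j\,[\zeta^\pm(\ell_j)]_y .$$ Furthermore, for every broken trace $\ell\subseteq\bar S$, $$w_\eta(\ell)=\sum_{\ell'\in C(S)} w_\eta(\ell')\,\mathbf{1}_{\{\ell\subseteq\ell'\}}.$$ By part (b), the flow field constructed in part (a) also satisfies all of these decompositions and the weight formula.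
   Context: Lattice and edges. $\tilde{\mathbb{Z}}^2=\{(t,x)\in\mathbb{Z}^2:t+x\text{ even}\}$; edges $\langle y,y'\rangle$ join points at distance $\sqrt2$. For $y=(t,x)$: - $e^\nearrow_y=\langle(t,x),(t+1,x+1)\rangle$, - $e^\searrow_y=\langle(t,x),(t+1,x-1)\rangle$, - $e^\swarrow_y=\langle(t-1,x-1),(t,x)\rangle$, - $e^\nwarrow_y=\langle(t-1,x+1),(t,x)\rangle$. Domains. A rectangular domain is a nonempty set $S=\{(t,x)\in\tilde{\mathbb{Z}}^2: a\le t+x\le b,\ c\le t-x\le d\}$ with even integers $a\le b$, $c\le d$. $\bar S$ is $S$ together with all points joined by an edge to a point of $S$; $\partial\bar S=\bar S\setminus S$; $\mathbb{E}(\bar S)$ is the set of edges with at least one endpoint in $S$. Flow field and its associated fields. A flow field is $\eta(e)\ge0$, $e\in\mathbb{E}(\bar S)$, with $\eta(e^\nwarrow_y)+\eta(e^\nearrow_y)=\eta(e^\swarrow_y)+\eta(e^\searrow_y)$ for all $y\in S$. - Its birth field is $\xi_y=\eta(e^\nearrow_y)\wedge\eta(e^\searrow_y)$, $y\in S$. - Its boundary inflows are $\zeta^+_y=\eta(e^\swarrow_y)$ for $y=(t,x)\in S$ with $(t-1,x-1)\in\partial\bar S$, and $\zeta^-_y=\eta(e^\nwarrow_y)$ for $y\in S$ with $(t-1,x+1)\in\partial\bar S$. Association. For $y\in S$, a lower edge $f_1\in\{e^\swarrow_y,e^\searrow_y\}$ with $p_1\in(0,\eta(f_1)]$, and an upper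 edge $f_2\in\{e^\nwarrow_y,e^\nearrow_y\}$ with $p_2\in(0,\eta(f_2)]$, write $(f_1,p_1)\sim_y(f_2,p_2)$ exactly when: - Case 1: $f_1=e^\swarrow_y$, $f_2=e^\nwarrow_y$, $p_1\le\eta(f_1)\wedge\eta(f_2)$, $p_2=p_1$; - Case 2: $f_1=e^\searrow_y$, $f_2=e^\nwarrow_y$, $p_2>\eta(e^\swarrow_y)$, $p_1=p_2-\eta(e^\swarrow_y)$; - Case 3: $f_1=e^\swarrow_y$, $f_2=e^\nearrow_y$, $p_1>\eta(e^\nwarrow_y)$, $p_2=p_1-\eta(e^\nwarrow_y)$; - Case 4: $f_1=e^\searrow_y$, $f_2=e^\nearrow_y$, $p_i>\eta(f_i)-\xi_y$ ($i=1,2$), $\eta(f_1)-p_1=\eta(f_2)-p_2$. Broken traces. A broken trace is $\ell=(y_0,e_1,y_1,\dots,e_n,y_n)$, $n\ge1$, with $y_i=(t_i,x_i)\in\tilde{\mathbb{Z}}^2$, $e_i=\langle y_{i-1},y_i\rangle$, $x_i=x_{i-1}+1$, $t_i-t_{i-1}\in\{-1,1\}$. - $D(\ell)=\{x_0,\dots,x_n\}$, and $t_\ell(x)$ is the $t$-coordinate of the vertex of $\ell$ at second coordinate $x$. - $\ell\subseteq\bar S$ means $y_0,y_n\in\bar S$, $y_1,\dots,y_{n-1}\in S$, all $e_i\in\mathbb{E}(\bar S)$. - $C(S)$ is the set of $\ell\subseteq\bar S$ with $y_0,y_n\in\partial\bar S$. - $L(\ell)$ (left corners) is the set of vertices $(t,x)$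 of $\ell$ such that $(t+1,x-1)$ and $(t+1,x+1)$ are both vertices of $\ell$. - $[\zeta^+(\ell)]_{(t,x)}=1$ if $(t,x)\in S$ is a vertex of $\ell$ and $(t-1,x-1)$ is a vertex of $\ell$ lying in $\partial\bar S$; otherwise it is $0$. - $[\zeta^-(\ell)]_{(t,x)}=1$ if $(t,x)\in S$ is a vertex of $\ell$ and $(t-1,x+1)$ is a vertex of $\ell$ lying in $\partial\bar S$; otherwise it is $0$. Weight. $w_\eta(\ell)$, for $\ell\subseteq\bar S$, is the Lebesgue measure of the set of $p_1\in(0,\eta(e_1)]$ for which there exist $p_i\in(0,\eta(e_i)]$ ($i=2,\dots,n$) with $(e_{i-1},p_{i-1})\sim_{y_{i-1}}(e_i,p_i)$ for all $i=2,\dots,n$. Relations between traces. - $\ell\subseteq\ell'$ means $D(\ell)\subseteq D(\ell')$ and $t_\ell=t_{\ell'}$ on $D(\ell)$. - $\ell\succeq\ell'$ means $t_\ell(x)\ge t_{\ell'}(x)$ for all $x\in D(\ell)\cap D(\ell')$, and $t_\ell(x)\ge t_{\ell'}(x')$ for some $x\in D(\ell)$, $x'\in D(\ell')$. - $\ell\succ\ell'$ means $\ell\succeq\ell'$ and $\ell\ne\ell'$; $\ell\prec\ell'$ means $\ell'\succ\ell$. *)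

(* Defs.v *)
From Stdlib Require Import Reals ZArith List ClassicalEpsilon.
Import ListNotations.
Open Scope R_scope.

Definition pt : Type := (Z * Z)%type.
Definition tc (y : pt) : Z := fst y.
Definition xc (y : pt) : Z := snd y.

Definition in_lattice (y : pt) : Prop := Z.Even (tc y + xc y).

Definition adjacent (y y' : pt) : Prop :=
  Z.abs (tc y - tc y') = 1%Z /\ Z.abs (xc y - xc y') = 1%Z.

Record rect := mkRect { ra : Z; rb : Z; rc : Z; rd : Z }.

Definition inS (S : rect) (y : pt) : Prop :=
  in_lattice y /\
  (ra S <= tc y + xc y <= rb S)%Z /\ (rc S <= tc y - xc y <= rd S)%Z.

Definition inSbar (S : rect) (y : pt) : Prop :=
  inS S y \/ exists y', inS S y' /\ adjacent y y'.

Definition inBd (S : rect) (y : pt) : Prop := inSbar S y /\ ~ inS S y.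

(* An edge <y, y'> is represented canonically by its endpoint with the smaller
   t-coordinate, together with a direction: true means the other endpoint is
   (t+1, x+1), false means it is (t+1, x-1). *)
Definition edge : Type := (pt * bool)%type.
Definition e_lo (e : edge) : pt := fst e.
Definition e_hi (e : edge) : pt :=
  ((tc (fst e) + 1)%Z, if snd e then (xc (fst e) + 1)%Z else (xc (fst e) - 1)%Z).

Definition eNE (y : pt) : edge := (y, true).
Definition eSE (y : pt) : edge := (y, false).
Definition eSW (y : pt) : edge := (((tc y - 1)%Z, (xc y - 1)%Z), true).
Definition eNW (y : pt) : edge := (((tc y - 1)%Z, (xc y + 1)%Z), false).

Definition inE (S : rect) (e : edge) : Prop := inS S (e_lo e) \/ inS S (e_hi e).

Definition mkedge (y y' : pt) : edge :=
  if (tc y <? tc y')%Z then (y, (xc y' =? xc y + 1)%Z)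
  else (y', (xc y =? xc y' + 1)%Z).

(* eta is a flow field on E(Sbar); its values off E(Sbar) are irrelevant. *)
Definition is_flow (S : rect) (eta : edge -> R) : Prop :=
  (forall e, inE S e -> 0 <= eta e) /\
  (forall y, inS S y -> eta (eNW y) + eta (eNE y) = eta (eSW y) + eta (eSE y)).

Definition birth (eta : edge -> R) (y : pt) : R := Rmin (eta (eNE y)) (eta (eSE y)).

(* boundary inflows (meaningful for y in S with (t-1,x-1) resp. (t-1,x+1) in dSbar) *)
Definition zeta_plus (eta : edge -> R) (y : pt) : R := eta (eSW y).
Definition zeta_minus (eta : edge -> R) (y : pt) : R := eta (eNW y).

Definition assoc (eta : edge -> R) (y : pt) (f1 : edge) (p1 : R) (f2 : edge) (p2 : R) : Prop :=
  (f1 = eSW y \/ f1 = eSE y) /\ 0 < p1 <= eta f1 /\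
  (f2 = eNW y \/ f2 = eNE y) /\ 0 < p2 <= eta f2 /\
  ( (f1 = eSW y /\ f2 = eNW y /\ p1 <= Rmin (eta f1) (eta f2) /\ p2 = p1)
  \/ (f1 = eSE y /\ f2 = eNW y /\ p2 > eta (eSW y) /\ p1 = p2 - eta (eSW y))
  \/ (f1 = eSW y /\ f2 = eNE y /\ p1 > eta (eNW y) /\ p2 = p1 - eta (eNW y))
  \/ (f1 = eSE y /\ f2 = eNE y /\ p1 > eta f1 - birth eta y /\ p2 > eta f2 - birth eta y
      /\ eta f1 - p1 = eta f2 - p2) ).

(* A broken trace (y_0, e_1, y_1, ..., e_n, y_n) is represented by its list of
   vertices [y_0; ...; y_n]; the edges are determined by the vertices. *)
Definition trace : Type := list pt.
Definition vert (l : trace) (i : nat) : pt := nth i l (0%Z, 0%Z).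
Definition tlen (l : trace) : nat := (length l - 1)%nat.
(* the edge e_{k+1} joining y_k and y_{k+1} (0-based index k) *)
Definition tedge (l : trace) (k : nat) : edge := mkedge (vert l k) (vert l (S k)).

Definition is_trace (l : trace) : Prop :=
  (2 <= length l)%nat /\
  (forall i, (i < length l)%nat -> in_lattice (vert l i)) /\
  (forall i, (S i < length l)%nat ->
     xc (vert l (S i)) = (xc (vert l i) + 1)%Z /\
     (tc (vert l (S i)) = (tc (vert l i) + 1)%Z \/ tc (vert l (S i)) = (tc (vert l i) - 1)%Z)).

Definition is_edge_of (e : edge) (l : trace) : Prop :=
  exists k, (k < tlen l)%nat /\ e = tedge l k.

Definition sub_Sbar (S : rect) (l : trace) : Prop :=
  is_trace l /\ inSbar S (vert l 0) /\ inSbar S (vert l (tlen l)) /\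
  (forall i, (0 < i < tlen l)%nat -> inS S (vert l i)) /\
  (forall k, (k < tlen l)%nat -> inE S (tedge l k)).

Definition inC (S : rect) (l : trace) : Prop :=
  sub_Sbar S l /\ inBd S (vert l 0) /\ inBd S (vert l (tlen l)).

Definition inD (l : trace) (x : Z) : Prop :=
  exists i, (i < length l)%nat /\ xc (vert l i) = x.
Definition tl (l : trace) (x : Z) : Z := tc (vert l (Z.to_nat (x - xc (vert l 0)))).

Definition is_left_corner (l : trace) (y : pt) : Prop :=
  In y l /\ In ((tc y + 1)%Z, (xc y - 1)%Z) l /\ In ((tc y + 1)%Z, (xc y + 1)%Z) l.

(* [zeta^+(l)]_y = 1 and [zeta^-(l)]_y = 1 *)
Definition zplus_tr (S : rect) (l : trace) (y : pt) : Prop :=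
  inS S y /\ In y l /\ In ((tc y - 1)%Z, (xc y - 1)%Z) l /\ inBd S ((tc y - 1)%Z, (xc y - 1)%Z).
Definition zminus_tr (S : rect) (l : trace) (y : pt) : Prop :=
  inS S y /\ In y l /\ In ((tc y - 1)%Z, (xc y + 1)%Z) l /\ inBd S ((tc y - 1)%Z, (xc y + 1)%Z).

Definition subtrace (l l' : trace) : Prop :=
  (forall x, inD l x -> inD l' x) /\ (forall x, inD l x -> tl l x = tl l' x).
Definition succeq (l l' : trace) : Prop :=
  (forall x, inD l x -> inD l' x -> (tl l x >= tl l' x)%Z) /\
  (exists x x', inD l x /\ inD l' x' /\ (tl l x >= tl l' x')%Z).
Definition succ (l l' : trace) : Prop := succeq l l' /\ l <> l'.
Definition prec (l l' : trace) : Prop := succ l' l.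

Definition is_glb (E : R -> Prop) (m : R) : Prop :=
  (forall x, E x -> m <= x) /\ (forall m', (forall x, E x -> m' <= x) -> m' <= m).
Definition Rinf (E : R -> Prop) : R := epsilon (inhabits 0) (is_glb E).
Definition cover_length (A : R -> Prop) (s : R) : Prop :=
  exists a b : nat -> R,
    (forall k, a k <= b k) /\ (forall x, A x -> exists k, a k < x < b k) /\
    infinite_sum (fun k => b k - a k) s.
Definition lebesgue_measure (A : R -> Prop) : R := Rinf (cover_length A).

Definition weight_set (eta : edge -> R) (l : trace) (p1 : R) : Prop :=
  0 < p1 <= eta (tedge l 0) /\
  exists ps : nat -> R, ps 0%nat = p1 /\
    (forall k, (k < tlen l)%nat -> 0 < ps k <= eta (tedge l k)) /\
    (forall k, (S k < tlen l)%nat ->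
       assoc eta (vert l (S k)) (tedge l k) (ps k) (tedge l (S k)) (ps (S k))).
Definition weight (eta : edge -> R) (l : trace) : R := lebesgue_measure (weight_set eta l).

Definition indic (P : Prop) : R := if excluded_middle_informative P then 1 else 0.
Definition sumR (l : list R) : R := fold_right Rplus 0 l.
Definition wsum (ls : list trace) (ws : list R) (f : trace -> R) : R :=
  sumR (map (fun p => snd p * f (fst p)) (combine ls ws)).

Definition valid_data (S : rect) (ls : list trace) (ws : list R) : Prop :=
  length ws = length ls /\
  (forall j, (j < length ls)%nat -> inC S (nth j ls [])) /\
  (forall i j, (i < j < length ls)%nat -> prec (nth i ls []) (nth j ls [])) /\
  (forall j, (j < length ws)%nat -> 0 < nth j ws 0).

Definition charac (S : rect) (eta : edge -> R) (ls : list trace) (ws : list R) : Prop :=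
  forall l, inC S l ->
    (forall j, (j < length ls)%nat -> l = nth j ls [] -> weight eta l = nth j ws 0) /\
    ((forall j, (j < length ls)%nat -> l <> nth j ls []) -> weight eta l = 0).

Definition posC (S : rect) (eta : edge -> R) (l : trace) : Prop :=
  inC S l /\ weight eta l > 0.

(* Main.v *)
(** A flow field is divergence free on a simply connected piece of the lattice, so it is
    the gradient, across edges, of a height function [H] on the faces that is monotone in
    both characteristic directions [t + x] and [t - x].  The position [p] on an edge [e]
    corresponds to the absolute height [h = early H e + p], and [~_y] relates exactly the
    positions of equal height.  Hence the weight of a trace is the length of the interval
    of heights [h] such that [early H e < h <= late H e] for all its edges [e].

    For a given [h], the edges crossed by the level [h] form a single trace of [C(S)], which
    moves later as [h] grows; it is constant between consecutive values of [H], so these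
    level lines are the chain of part (b) and every decomposition is a telescoping sum.
    Conversely a chain with weights gives [H] as the weighted sum of the indicators of the
    later sides of its traces, which are nested. *)
Require Import Defs.
From Stdlib Require Import Reals ZArith List ClassicalEpsilon.
From Stdlib Require Import Lra Lia Sorted.
Import ListNotations.
Open Scope R_scope.

(** The delicate point is the comparison of crossings whose ranges of [x] are disjoint, where
    looking at a common [x] gives nothing. Extending [H] to all integer indices by clamping makes
    monotonicity available at vertices on the boundary too; together with the sides of the rectangle
    on which crossings start and end, this settles those cases. On arbitrary traces [succeq] is not
    visibly an order. Antisymmetry and transitivity are obtained by passing to later sides, which
    are compared by inclusion. Levels are half-open, [early < h <= late], because positions on an
    edge range over [(0, eta e]]. Hence a gap between consecutive heights is [(V k, V (S k)]] and is
    represented by its upper end. *)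

(** * The measure of a half-open interval *)

Lemma sum_f_R0_gain (f g : nat -> R) (k N : nat) (d : R) :
  (forall i, f i <= g i) -> (k <= N)%nat -> f k + d <= g k ->
  sum_f_R0 f N + d <= sum_f_R0 g N.
Proof.
  intros Hfg Hk Hd; induction N as [|N IH]; simpl.
  - assert (k = 0%nat) as -> by lia; exact Hd.
  - destruct (Nat.eq_dec k (S N)) as [->|Hne].
    + assert (sum_f_R0 f N <= sum_f_R0 g N) by (apply sum_Rle; auto); lra.
    + assert (sum_f_R0 f N + d <= sum_f_R0 g N) by (apply IH; lia).
      specialize (Hfg (S N)); lra.
Qed.

Lemma sum_f_R0_extend (f : nat -> R) (N M : nat) :
  (forall i, 0 <= f i) -> (N <= M)%nat -> sum_f_R0 f N <= sum_f_R0 f M.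
Proof.
  intros Hf; induction 1 as [|M _ IH]; simpl; [lra|]; specialize (Hf (S M)); lra.
Qed.

(** A supremum argument in place of Heine-Borel: [P c] says that finitely many of the intervals,
    counted only below [c], already pay for [[l, c]]. The interval around the supremum also pays for
    a stretch beyond it, so the supremum cannot stay short of [r]. *)
Lemma compact_cover_length (a b : nat -> R) (l r : R) :
  l <= r -> (forall k, a k <= b k) ->
  (forall x, l <= x <= r -> exists k, a k < x < b k) ->
  exists N, r - l <= sum_f_R0 (fun k => b k - a k) N.
Proof.
  intros Hlr Hab Hcov.
  (* Length of the part of the [k]-th interval below [c]. *)
  set (g := fun (c : R) (k : nat) => Rmax 0 (Rmin (b k) c - a k)).
  assert (Hg0 : forall c k, 0 <= g c k) by (intros; apply Rmax_l).
  assert (Hgm : forall c c' k, c <= c' -> g c k <= g c' k).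
  { intros c c' k Hc; unfold g, Rmax, Rmin; repeat destruct Rle_dec; lra. }
  set (P := fun c => l <= c <= r /\ exists N, c - l <= sum_f_R0 (g c) N).
  destruct (completeness P) as [s [Hub Hlub]].
  { exists r; intros c [Hc _]; lra. }
  { exists l; split; [lra|]; exists 0%nat; simpl; specialize (Hg0 l 0%nat); lra. }
  assert (Hs : l <= s <= r).
  { split.
    - apply Hub; split; [lra|]; exists 0%nat; simpl; specialize (Hg0 l 0%nat); lra.
    - apply Hlub; intros c [Hc _]; lra. }
  destruct (Hcov s Hs) as [k Hk].
  assert (exists c, P c /\ a k < c) as [c [[Hc [N HN]] Hak]].
  { destruct (excluded_middle_informative (exists c, P c /\ a k < c)) as [H|H]; [exact H|].
    exfalso; assert (s <= a k); [|lra].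
    apply Hlub; intros c Pc; destruct (Rle_dec c (a k)); [assumption|].
    exfalso; apply H; exists c; split; [exact Pc|lra]. }
  assert (Hcs : c <= s) by (apply Hub; split; [exact Hc|exists N; exact HN]).
  (* A point of the [k]-th interval beyond [s], capped at [r]; once [P c'] holds, the supremum
     leaves only [c' = r]. *)
  set (c' := Rmin r ((s + b k) / 2)).
  assert (Hc' : s <= c' <= r /\ c' < b k /\ (c' = r \/ s < c')).
  { unfold c', Rmin; destruct Rle_dec; lra. }
  destruct Hc' as [Hc' [Hcb Hcase]].
  assert (HP : P c').
  { split; [lra|]; exists (Nat.max N k).
    assert (sum_f_R0 (g c) (Nat.max N k) + (c' - c) <= sum_f_R0 (g c') (Nat.max N k)).
    { apply sum_f_R0_gain with k; [intro; apply Hgm; lra|lia|].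
      unfold g, Rmax, Rmin; repeat destruct Rle_dec; lra. }
    assert (sum_f_R0 (g c) N <= sum_f_R0 (g c) (Nat.max N k))
      by (apply sum_f_R0_extend; [apply Hg0|lia]).
    lra. }
  pose proof (Hub _ HP).
  assert (Er : c' = r) by lra.
  destruct HP as [_ [M HM]]; exists M; rewrite Er in HM.
  apply Rle_trans with (1 := HM), sum_Rle; intros i _.
  specialize (Hab i); unfold g, Rmax, Rmin; repeat destruct Rle_dec; lra.
Qed.

Lemma lebesgue_measure_interval (A : R -> Prop) (lo hi : R) :
  (forall p, A p <-> lo < p <= hi) -> lo <= hi -> lebesgue_measure A = hi - lo.
Proof.
  intros HA Hle.
  assert (Hglb : is_glb (cover_length A) (hi - lo)).
  { split.
    - intros s (a & b & Hab & Hcov & Hsum).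
      assert (Hpos : forall k, 0 <= b k - a k) by (intro k; specialize (Hab k); lra).
      assert (Hpart : forall N, sum_f_R0 (fun k => b k - a k) N <= s)
        by (intro N; apply sum_incr; assumption).
      apply le_epsilon; intros eps Heps.
      (* The half-open interval is not compact; [[lo + eps, hi]] is, at the cost of [eps]. *)
      destruct (Rle_dec (lo + eps) hi) as [Hlt|Hge].
      + destruct (compact_cover_length a b (lo + eps) hi Hlt Hab) as [N HN].
        { intros x Hx; apply Hcov, HA; lra. }
        specialize (Hpart N); lra.
      + specialize (Hpart 0%nat); specialize (Hpos 0%nat); simpl in Hpart; lra.
    - intros m Hm; apply le_epsilon; intros eps Heps; apply Hm.
      (* One interval overshooting [hi] by [eps], padded with empty ones. *)
      exists (fun k => match k with 0%nat => lo | _ => 0 end),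
             (fun k => match k with 0%nat => hi + eps | _ => 0 end).
      split; [intros [|k]; lra|split].
      + intros x Hx; apply HA in Hx; exists 0%nat; lra.
      + intros e He; exists 0%nat; intros n _.
        replace (sum_f_R0 _ n) with (hi - lo + eps).
        * rewrite (proj2 (Rdist_refl _ _)); [exact He|reflexivity].
        * induction n as [|n IH]; simpl; [lra|rewrite <- IH; lra]. }
  (* [Rinf] is chosen by [epsilon], so its value is known only through the uniqueness of the
     greatest lower bound. *)
  assert (HR : is_glb (cover_length A) (lebesgue_measure A))
    by (unfold lebesgue_measure, Rinf; apply epsilon_spec; eauto).
  destruct Hglb as [H1 H2], HR as [H3 H4].
  apply Rle_antisym; auto.
Qed.

(** * Characteristic coordinates *)

Definition uc (y : pt) : Z := (tc y + xc y)%Z.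
Definition vc (y : pt) : Z := (tc y - xc y)%Z.

Lemma pt_eq (y z : pt) : uc y = uc z -> vc y = vc z -> y = z.
Proof.
  destruct y as [t x], z as [t' x']; unfold uc, vc, tc, xc; simpl; intros.
  f_equal; lia.
Qed.

Definition even_rect (Q : rect) : Prop :=
  Z.Even (ra Q) /\ Z.Even (rb Q) /\ Z.Even (rc Q) /\ Z.Even (rd Q) /\
  (ra Q <= rb Q)%Z /\ (rc Q <= rd Q)%Z.

Lemma inS_uv (Q : rect) (y : pt) :
  inS Q y <-> Z.Even (uc y) /\ (ra Q <= uc y <= rb Q)%Z /\ (rc Q <= vc y <= rd Q)%Z.
Proof. reflexivity. Qed.

Lemma adjacent_uv (y z : pt) :
  adjacent y z <->
  (vc z = vc y /\ (uc z = uc y + 2 \/ uc z = uc y - 2)%Z) \/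
  (uc z = uc y /\ (vc z = vc y + 2 \/ vc z = vc y - 2)%Z).
Proof. unfold adjacent, uc, vc; lia. Qed.

Lemma even_add2 (z : Z) : Z.Even z -> Z.Even (z + 2).
Proof. intros [k ->]; exists (k + 1)%Z; lia. Qed.

Lemma even_sub2 (z : Z) : Z.Even z -> Z.Even (z - 2).
Proof. intros [k ->]; exists (k - 1)%Z; lia. Qed.

Lemma inSbar_even (Q : rect) (y : pt) : inSbar Q y -> Z.Even (uc y).
Proof.
  intros [H|[z [H Hadj]]]; rewrite inS_uv in H; destruct H as [[k Hk] _]; [now exists k|].
  apply adjacent_uv in Hadj.
  destruct Hadj as [[_ [H|H]]|[H _]];
    [exists (k - 1)%Z|exists (k + 1)%Z|exists k]; lia.
Qed.

Lemma inSbar_bounds (Q : rect) (y : pt) : inSbar Q y ->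
  (ra Q - 2 <= uc y <= rb Q + 2 /\ rc Q - 2 <= vc y <= rd Q + 2)%Z.
Proof.
  intros [H|[z [H Hadj]]]; rewrite inS_uv in H; destruct H as [_ H]; [lia|].
  apply adjacent_uv in Hadj; lia.
Qed.

(** A neighbour differs in exactly one of [u], [v], and by 2. So the boundary consists of four sides
    without corner points, and parity places them at distance exactly 2. *)
Lemma inBd_uv (Q : rect) (y : pt) : even_rect Q -> inBd Q y ->
  ((uc y = ra Q - 2 \/ uc y = rb Q + 2) /\ rc Q <= vc y <= rd Q)%Z \/
  ((vc y = rc Q - 2 \/ vc y = rd Q + 2) /\ ra Q <= uc y <= rb Q)%Z.
Proof.
  intros (Ea & Eb & Ec & Ed & Hab & Hcd) [Hb Hn].
  pose proof (inSbar_even Q y Hb) as Hev.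
  destruct Hb as [Hy|[z [Hz Hadj]]]; [contradiction|].
  rewrite inS_uv in Hz; destruct Hz as [[k Ek] Hz].
  destruct Ea as [a Ea], Eb as [b Eb], Ec as [c Ec], Ed as [d Ed].
  rewrite inS_uv in Hn.
  assert (Hn' : ~ ((ra Q <= uc y <= rb Q)%Z /\ (rc Q <= vc y <= rd Q)%Z)) by tauto.
  destruct Hev as [m Em].
  assert (Ez : vc z = (2 * k - 2 * xc z)%Z) by (unfold uc, vc in *; lia).
  assert (Ev : vc y = (2 * m - 2 * xc y)%Z) by (unfold uc, vc in *; lia).
  apply adjacent_uv in Hadj; lia.
Qed.

(** * Broken traces *)

(* In the coordinates [u = t + x], [v = t - x] a step of a broken trace either
   raises [u] by 2 or lowers [v] by 2. *)
Definition step_up (y z : pt) : Prop := uc z = (uc y + 2)%Z /\ vc z = vc y.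
Definition step_down (y z : pt) : Prop := uc z = uc y /\ vc z = (vc y - 2)%Z.

Lemma mkedge_up (y z : pt) : step_up y z -> mkedge y z = (y, true).
Proof.
  unfold step_up, uc, vc, mkedge; intros [H1 H2].
  replace (tc y <? tc z)%Z with true by (symmetry; apply Z.ltb_lt; lia).
  f_equal; apply Z.eqb_eq; lia.
Qed.

Lemma mkedge_down (y z : pt) : step_down y z -> mkedge y z = (z, false).
Proof.
  unfold step_down, uc, vc, mkedge; intros [H1 H2].
  replace (tc y <? tc z)%Z with false by (symmetry; apply Z.ltb_ge; lia).
  f_equal; apply Z.eqb_neq; lia.
Qed.

Lemma trace_step (l : trace) (k : nat) : is_trace l -> (k < tlen l)%nat ->
  step_up (vert l k) (vert l (S k)) \/ step_down (vert l k) (vert l (S k)).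
Proof.
  unfold tlen; intros (_ & _ & H) Hk; destruct (H k) as [Hx Ht]; [lia|].
  unfold step_up, step_down, uc, vc; lia.
Qed.

Lemma is_trace_steps (l : trace) : (2 <= length l)%nat ->
  Z.Even (uc (vert l 0)) ->
  (forall k, (k < tlen l)%nat ->
     step_up (vert l k) (vert l (S k)) \/ step_down (vert l k) (vert l (S k))) ->
  is_trace l.
Proof.
  unfold tlen; intros Hl H0 Hst; split; [exact Hl|split].
  - induction i as [|i IH]; intros Hi; [exact H0|].
    destruct IH as [m Hm]; [lia|].
    assert (E : uc (vert l i) = (2 * m)%Z) by exact Hm.
    destruct (Hst i) as [[H _]|[H _]]; [lia| |];
      [exists (m + 1)%Z|exists m]; unfold uc in E, H; lia.
  - intros i Hi; destruct (Hst i) as [[H1 H2]|[H1 H2]]; try lia;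
      unfold uc, vc in H1, H2; lia.
Qed.

Lemma trace_even (l : trace) (i : nat) : is_trace l -> (i <= tlen l)%nat -> Z.Even (uc (vert l i)).
Proof. unfold tlen; intros (H2 & H & _) Hi; apply H; lia. Qed.

Lemma vert_xc (l : trace) (i : nat) : is_trace l -> (i <= tlen l)%nat ->
  xc (vert l i) = (xc (vert l 0) + Z.of_nat i)%Z.
Proof.
  intros Hl; induction i as [|i IH]; intros Hi; [lia|].
  destruct (trace_step l i Hl) as [[H1 H2]|[H1 H2]]; try lia;
    unfold uc, vc in H1, H2; lia.
Qed.

Lemma trace_mono (l : trace) (i k : nat) : is_trace l -> (i <= k)%nat -> (k <= tlen l)%nat ->
  (uc (vert l i) <= uc (vert l k) /\ vc (vert l k) <= vc (vert l i))%Z.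
Proof.
  intros Hl; induction 1 as [|k Hik IH]; intros Hk; [lia|].
  destruct (trace_step l k Hl) as [[H1 H2]|[H1 H2]]; lia.
Qed.

Lemma tlen_pos (l : trace) : is_trace l -> (1 <= tlen l)%nat.
Proof. unfold tlen; intros [H _]; lia. Qed.

Lemma length_tlen (l : trace) : is_trace l -> length l = S (tlen l).
Proof. unfold tlen; intros [H _]; lia. Qed.

Lemma In_vert (l : trace) (y : pt) : is_trace l ->
  In y l <-> exists i, (i <= tlen l)%nat /\ vert l i = y.
Proof.
  intros Hl; pose proof (length_tlen l Hl) as Hn; split.
  - intros Hy; destruct (In_nth l y (0%Z, 0%Z) Hy) as [i [Hi E]].
    exists i; split; [lia|exact E].
  - intros [i [Hi <-]]; apply nth_In; lia.
Qed.

Lemma inD_range (l : trace) (x : Z) : is_trace l ->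
  inD l x <-> (xc (vert l 0) <= x <= xc (vert l (tlen l)))%Z.
Proof.
  intros Hl; pose proof (length_tlen l Hl) as Hn.
  pose proof (vert_xc l (tlen l) Hl (le_n _)) as He; split.
  - intros [i [Hi <-]]; rewrite (vert_xc l i Hl); lia.
  - intros Hx; exists (Z.to_nat (x - xc (vert l 0))); split; [lia|].
    rewrite vert_xc by (assumption || lia); lia.
Qed.

Lemma tl_vert (l : trace) (i : nat) : is_trace l -> (i <= tlen l)%nat ->
  Defs.tl l (xc (vert l i)) = tc (vert l i).
Proof.
  intros Hl Hi; unfold Defs.tl; do 2 f_equal.
  rewrite (vert_xc l i Hl Hi); lia.
Qed.

Lemma inD_vert (l : trace) (x : Z) : is_trace l ->
  inD l x <-> exists i, (i <= tlen l)%nat /\ xc (vert l i) = x.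
Proof.
  intros Hl; unfold inD; rewrite (length_tlen l Hl).
  split; intros [i [Hi E]]; exists i; split; auto; lia.
Qed.

(** A trace has one vertex at each [x] of its domain, so agreement of the functions [t] is inclusion
    of the vertex sets. *)
Lemma subtrace_incl (l l' : trace) : is_trace l -> is_trace l' ->
  (subtrace l l' <-> incl l l').
Proof.
  intros Hl Hl'; split.
  - intros [HD Ht] y Hy; apply In_vert in Hy; [|assumption].
    destruct Hy as [i [Hi <-]].
    assert (Hx : inD l (xc (vert l i))) by (apply inD_vert; eauto).
    destruct (proj1 (inD_vert l' _ Hl') (HD _ Hx)) as [j [Hj Ej]].
    specialize (Ht _ Hx); rewrite tl_vert in Ht by assumption.
    rewrite <- Ej, tl_vert in Ht by assumption.
    apply In_vert; [assumption|]; exists j; split; [assumption|].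
    destruct (vert l' j), (vert l i); unfold tc, xc in *; simpl in *; congruence.
  - intros Hincl.
    assert (H : forall i, (i <= tlen l)%nat -> exists j, (j <= tlen l')%nat /\ vert l' j = vert l i).
    { intros i Hi; apply In_vert; [assumption|]; apply Hincl, In_vert; eauto. }
    split; intros x Hx; apply inD_vert in Hx; auto; destruct Hx as [i [Hi <-]];
      destruct (H i Hi) as [j [Hj Ej]].
    + apply inD_vert; [assumption|]; exists j; split; [assumption|congruence].
    + rewrite tl_vert by assumption; rewrite <- Ej, tl_vert by assumption; reflexivity.
Qed.

Lemma vert_eq_index (l : trace) (i j : nat) (d : Z) : is_trace l ->
  (i <= tlen l)%nat -> (j <= tlen l)%nat ->
  xc (vert l j) = (xc (vert l i) + d)%Z -> Z.of_nat j = (Z.of_nat i + d)%Z.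
Proof.
  intros Hl Hi Hj E.
  rewrite (vert_xc l i), (vert_xc l j) in E by assumption; lia.
Qed.

(** Traces run towards growing [x]: they cross an edge with flag [true] from [e_lo] to [e_hi], and
    one with flag [false] from [e_hi] to [e_lo]. *)
Lemma edge_ends (e : edge) :
  if snd e then step_up (e_lo e) (e_hi e) else step_down (e_hi e) (e_lo e).
Proof.
  destruct e as [[t x] [|]]; unfold step_up, step_down, uc, vc, e_lo, e_hi, tc, xc; simpl; lia.
Qed.

Lemma mkedge_ends (e : edge) :
  (if snd e then mkedge (e_lo e) (e_hi e) else mkedge (e_hi e) (e_lo e)) = e.
Proof.
  pose proof (edge_ends e) as H; destruct e as [y [|]]; simpl in *.
  - now apply mkedge_up.
  - now apply mkedge_down.
Qed.

(** The ends of an edge differ by 1 in [x], so if both are vertices of a trace they are consecutive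
    there. Questions about edges thus become questions about vertex sets. *)
Lemma is_edge_of_In (l : trace) (e : edge) : is_trace l ->
  (is_edge_of e l <-> In (e_lo e) l /\ In (e_hi e) l).
Proof.
  intros Hl; split.
  - intros [k [Hk ->]]; unfold tedge.
    assert (H1 : In (vert l k) l) by (apply In_vert; [assumption|]; exists k; split; [lia|auto]).
    assert (H2 : In (vert l (S k)) l) by (apply In_vert; [assumption|]; exists (S k); split; [lia|auto]).
    destruct (trace_step l k Hl Hk) as [H|H].
    + rewrite (mkedge_up _ _ H); split; [exact H1|].
      replace (e_hi _) with (vert l (S k)); [exact H2|].
      pose proof (edge_ends (vert l k, true)) as E; simpl in E; unfold e_lo in E; simpl in E.
      destruct H, E; apply pt_eq; congruence.
    + rewrite (mkedge_down _ _ H); split; [exact H2|].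
      replace (e_hi _) with (vert l k); [exact H1|].
      pose proof (edge_ends (vert l (S k), false)) as E; simpl in E; unfold e_lo in E; simpl in E.
      destruct H, E; apply pt_eq; lia.
  - intros [H1 H2]; apply In_vert in H1, H2; auto.
    destruct H1 as [i [Hi Ei]], H2 as [j [Hj Ej]].
    pose proof (edge_ends e) as E; pose proof (mkedge_ends e) as M.
    destruct (snd e).
    + assert (Z.of_nat j = Z.of_nat i + 1)%Z.
      { apply (vert_eq_index l); auto; rewrite Ei, Ej; destruct E; unfold uc, vc in *; lia. }
      exists i; split; [lia|]; unfold tedge.
      replace (S i) with j by lia; rewrite Ei, Ej; auto.
    + assert (Z.of_nat i = Z.of_nat j + 1)%Z.
      { apply (vert_eq_index l); auto; rewrite Ei, Ej; destruct E; unfold uc, vc in *; lia. }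
      exists j; split; [lia|]; unfold tedge.
      replace (S j) with i by lia; rewrite Ei, Ej; auto.
Qed.

Lemma e_hi_up (y z : pt) : step_up y z -> e_hi (y, true) = z.
Proof.
  intros [H1 H2]; pose proof (edge_ends (y, true)) as [E1 E2]; apply pt_eq; unfold e_lo in *; simpl in *; lia.
Qed.

Lemma e_hi_down (y z : pt) : step_down y z -> e_hi (z, false) = y.
Proof.
  intros [H1 H2]; pose proof (edge_ends (z, false)) as [E1 E2]; apply pt_eq; unfold e_lo in *; simpl in *; lia.
Qed.

Lemma tedge_inE (Q : rect) (l : trace) (k : nat) : is_trace l -> (k < tlen l)%nat ->
  (inE Q (tedge l k) <-> inS Q (vert l k) \/ inS Q (vert l (S k))).
Proof.
  intros Hl Hk; unfold inE, tedge; destruct (trace_step l k Hl Hk) as [H|H].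
  - rewrite (mkedge_up _ _ H), (e_hi_up _ _ H); simpl; tauto.
  - rewrite (mkedge_down _ _ H), (e_hi_down _ _ H); simpl; tauto.
Qed.

(** Every edge but the first starts at an interior vertex, which lies in the domain; only the first
    edge has to be checked separately. *)
Lemma sub_Sbar_intro (Q : rect) (l : trace) : is_trace l ->
  inSbar Q (vert l 0) -> inSbar Q (vert l (tlen l)) ->
  (forall i, (0 < i < tlen l)%nat -> inS Q (vert l i)) ->
  inS Q (vert l 0) \/ inS Q (vert l 1) -> sub_Sbar Q l.
Proof.
  intros Hl H0 Hn Hi H01; split; [exact Hl|do 3 (split; [assumption|])].
  intros k Hk; apply tedge_inE; auto.
  destruct (Nat.eq_dec k 0) as [->|Hk0]; [exact H01|].
  left; apply Hi; lia.
Qed.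

Lemma sub_Sbar_bounds (Q : rect) (l : trace) (k : nat) : sub_Sbar Q l -> (k <= tlen l)%nat ->
  (ra Q - 2 <= uc (vert l k) <= rb Q + 2 /\ rc Q - 2 <= vc (vert l k) <= rd Q + 2)%Z.
Proof.
  intros (_ & H0 & Hn & Hi & _) Hk; apply inSbar_bounds.
  destruct (Nat.eq_dec k 0) as [->|]; [exact H0|].
  destruct (Nat.eq_dec k (tlen l)) as [->|]; [exact Hn|].
  left; apply Hi; lia.
Qed.

(** A step can only raise [u] or lower [v], so it enters the domain through the side of small [u] or
    the side of large [v]. [inC_end] is the mirror image. *)
Lemma inC_start (Q : rect) (l : trace) : even_rect Q -> inC Q l ->
  inS Q (vert l 1) /\
  ((uc (vert l 0) = ra Q - 2 /\ rc Q <= vc (vert l 0) <= rd Q)%Z \/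
   (vc (vert l 0) = rd Q + 2 /\ ra Q <= uc (vert l 0) <= rb Q)%Z).
Proof.
  intros HQ [(Hl & _ & _ & _ & HE) [H0 _]].
  pose proof (tlen_pos l Hl) as Hp.
  assert (H1 : inS Q (vert l 1)).
  { specialize (HE 0%nat Hp); apply tedge_inE in HE; auto.
    destruct HE as [HE|HE]; [destruct (proj2 H0 HE)|exact HE]. }
  split; [exact H1|].
  pose proof (inBd_uv Q _ HQ H0); rewrite inS_uv in H1.
  destruct (trace_step l 0 Hl Hp) as [[E1 E2]|[E1 E2]]; lia.
Qed.

Lemma inC_end (Q : rect) (l : trace) : even_rect Q -> inC Q l ->
  inS Q (vert l (tlen l - 1)) /\
  ((uc (vert l (tlen l)) = rb Q + 2 /\ rc Q <= vc (vert l (tlen l)) <= rd Q)%Z \/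
   (vc (vert l (tlen l)) = rc Q - 2 /\ ra Q <= uc (vert l (tlen l)) <= rb Q)%Z).
Proof.
  intros HQ [(Hl & _ & _ & _ & HE) [_ Hn]].
  pose proof (tlen_pos l Hl) as Hp.
  assert (Hk : (tlen l - 1 < tlen l)%nat) by lia.
  assert (HS : S (tlen l - 1) = tlen l) by lia.
  assert (H1 : inS Q (vert l (tlen l - 1))).
  { specialize (HE _ Hk); apply tedge_inE in HE; auto; rewrite HS in HE.
    destruct HE as [HE|HE]; [exact HE|destruct (proj2 Hn HE)]. }
  split; [exact H1|].
  pose proof (inBd_uv Q _ HQ Hn); rewrite inS_uv in H1.
  pose proof (trace_step l _ Hl Hk) as Hs; rewrite HS in Hs.
  destruct Hs as [[E1 E2]|[E1 E2]]; lia.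
Qed.

(** * Heights and levels *)

Definition clamp (lo hi z : Z) : Z := Z.max lo (Z.min hi z).

(* The face of the lattice to the later side of the vertex [(u, v)], centred at
   [(u + 1, v + 1)], carries the height [H u v]; the faces around that vertex are
   thus [H (u-2) (v-2)] (earlier), [H u (v-2)], [H (u-2) v] and [H u v] (later).
   Faces that do not touch [S] copy the height of the nearest face that does. *)
Definition is_height (Q : rect) (H : Z -> Z -> R) : Prop :=
  (forall u u' v v', (u <= u')%Z -> (v <= v')%Z -> H u v <= H u' v') /\
  (forall u v, H u v = H (clamp (ra Q - 2) (rb Q) u) (clamp (rc Q - 2) (rd Q) v)).

(** Both edges that leave a lattice point towards larger [t] have the face indexed by that point on
    their later side. The face on their earlier side is one step back, in [v] for flag [true] and in
    [u] for flag [false]. *)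
Definition late (H : Z -> Z -> R) (e : edge) : R := H (uc (e_lo e)) (vc (e_lo e)).
Definition early (H : Z -> Z -> R) (e : edge) : R :=
  if snd e then H (uc (e_lo e)) (vc (e_lo e) - 2)%Z else H (uc (e_lo e) - 2)%Z (vc (e_lo e)).

Definition is_potential (Q : rect) (eta : edge -> R) (H : Z -> Z -> R) : Prop :=
  is_height Q H /\ forall e, inE Q e -> eta e = late H e - early H e.

Definition edge_level (H : Z -> Z -> R) (h : R) (e : edge) : Prop := early H e < h <= late H e.

Definition at_level (H : Z -> Z -> R) (l : trace) (h : R) : Prop :=
  forall k, (k < tlen l)%nat -> edge_level H h (tedge l k).

(** A condition on a single vertex, implied by crossing any edge at it: the level passes between the
    earliest and the latest of the four faces around [y]. Level traces are compared through this
    condition. *)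
Definition vertex_level (H : Z -> Z -> R) (h : R) (y : pt) : Prop :=
  H (uc y - 2)%Z (vc y - 2)%Z < h <= H (uc y) (vc y).

Lemma edge_level_up (H : Z -> Z -> R) (h : R) (y z : pt) : step_up y z ->
  (edge_level H h (mkedge y z) <-> H (uc y) (vc y - 2)%Z < h <= H (uc y) (vc y)).
Proof. intros Hs; rewrite (mkedge_up _ _ Hs); reflexivity. Qed.

Lemma edge_level_down (H : Z -> Z -> R) (h : R) (y z : pt) : step_down y z ->
  (edge_level H h (mkedge y z) <-> H (uc y - 2)%Z (vc y - 2)%Z < h <= H (uc y) (vc y - 2)%Z).
Proof.
  intros Hs; rewrite (mkedge_down _ _ Hs); destruct Hs as [E1 E2].
  unfold edge_level, early, late; simpl; unfold e_lo; simpl; rewrite E1, E2; reflexivity.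
Qed.

Lemma edge_level_vertices (Q : rect) (H : Z -> Z -> R) (h : R) (y z : pt) :
  is_height Q H -> step_up y z \/ step_down y z -> edge_level H h (mkedge y z) ->
  vertex_level H h y /\ vertex_level H h z.
Proof.
  intros [Hm _] [Hs|Hs] He; unfold vertex_level.
  - apply edge_level_up in He; [|exact Hs]; destruct Hs as [-> ->].
    pose proof (Hm (uc y - 2) (uc y) (vc y - 2) (vc y - 2))%Z.
    pose proof (Hm (uc y) (uc y + 2) (vc y) (vc y))%Z.
    replace (uc y + 2 - 2)%Z with (uc y) by lia.
    split; split; try lra; [apply Rle_lt_trans with (2 := proj1 He)|apply Rle_trans with (1 := proj2 He)];
      match goal with X : _ -> _ -> ?A |- ?A => apply X; lia end.
  - apply edge_level_down in He; [|exact Hs]; destruct Hs as [-> ->].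
    pose proof (Hm (uc y) (uc y) (vc y - 2) (vc y))%Z.
    pose proof (Hm (uc y - 2) (uc y - 2) (vc y - 2 - 2) (vc y - 2))%Z.
    split; split; try lra; [apply Rle_trans with (1 := proj2 He)|apply Rle_lt_trans with (2 := proj1 He)];
      match goal with X : _ -> _ -> ?A |- ?A => apply X; lia end.
Qed.

Lemma at_level_vertex (Q : rect) (H : Z -> Z -> R) (h : R) (l : trace) (i : nat) :
  is_height Q H -> is_trace l -> at_level H l h -> (i <= tlen l)%nat ->
  vertex_level H h (vert l i).
Proof.
  intros HH Hl Hlev Hi; pose proof (tlen_pos l Hl).
  destruct (Nat.eq_dec i (tlen l)) as [->|Hne].
  - assert (Hk : (tlen l - 1 < tlen l)%nat) by lia.
    pose proof (trace_step l _ Hl Hk) as Hs; pose proof (Hlev _ Hk) as Ha.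
    unfold tedge in Ha; replace (S (tlen l - 1)) with (tlen l) in * by lia.
    exact (proj2 (edge_level_vertices _ _ _ _ _ HH Hs Ha)).
  - assert (Hk : (i < tlen l)%nat) by lia.
    pose proof (trace_step l _ Hl Hk) as Hs; pose proof (Hlev _ Hk) as Ha.
    exact (proj1 (edge_level_vertices _ _ _ _ _ HH Hs Ha)).
Qed.

(** Otherwise monotonicity closes a cycle: [h2] is at most the height of the later face of [y2],
    which is at most that of the earlier face of [y1], which is below [h1]. The clamps let the
    comparison ignore how far a boundary vertex sticks out of the rectangle. *)
Lemma vertex_level_cmp (Q : rect) (H : Z -> Z -> R) (h1 h2 : R) (y1 y2 : pt) :
  is_height Q H -> h1 <= h2 -> vertex_level H h1 y1 -> vertex_level H h2 y2 ->
  ~ ((clamp (ra Q - 2) (rb Q) (uc y2) <= clamp (ra Q - 2) (rb Q) (uc y1 - 2))%Z /\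
     (clamp (rc Q - 2) (rd Q) (vc y2) <= clamp (rc Q - 2) (rd Q) (vc y1 - 2))%Z).
Proof.
  intros [Hm Hc] Hh [H1 _] [_ H2] [Hu Hv].
  pose proof (Hm _ _ _ _ Hu Hv) as X; rewrite <- !Hc in X; lra.
Qed.

Lemma start_before_end (Q : rect) (H : Z -> Z -> R) (h : R) (l l' : trace) :
  even_rect Q -> is_height Q H -> inC Q l -> inC Q l' ->
  at_level H l h -> at_level H l' h ->
  (xc (vert l' 0) < xc (vert l (tlen l)))%Z.
Proof.
  intros HQ HH Hl Hl' Hlev Hlev'.
  destruct (inC_end Q l HQ Hl) as [_ He]; destruct (inC_start Q l' HQ Hl') as [_ Hs].
  pose proof (at_level_vertex Q H h l (tlen l) HH (proj1 (proj1 Hl)) Hlev (le_n _)) as V.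
  pose proof (at_level_vertex Q H h l' 0 HH (proj1 (proj1 Hl')) Hlev' ltac:(lia)) as V'.
  destruct HQ as (_ & _ & _ & _ & Hab & Hcd).
  pose proof (vertex_level_cmp Q H h h _ _ HH (Rle_refl _) V V') as N1.
  pose proof (vertex_level_cmp Q H h h _ _ HH (Rle_refl _) V' V) as N2.
  (* The trace [l] ends on the right or bottom side of the rotated rectangle, [l'] starts on
     its left or top side; right/left and bottom/top contradict the order of the heights. *)
  assert (E : forall y, (uc y - vc y = 2 * xc y)%Z) by (intro; unfold uc, vc; lia).
  pose proof (E (vert l (tlen l))); pose proof (E (vert l' 0)); clear E V V'.
  apply Znot_ge_lt; intros Hge.
  destruct He as [[]|[]], Hs as [[]|[]]; [|clear N1 N2; lia|clear N1 N2; lia|].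
  - apply N1; clear N1 N2; unfold clamp; lia.
  - apply N2; clear N1 N2; unfold clamp; lia.
Qed.

(** If [y2] came before [y1], parity would separate them by at least 2 in [t], hence by at least 2
    in both [u] and [v], which [vertex_level_cmp] excludes. *)
Lemma same_x_level (Q : rect) (H : Z -> Z -> R) (h1 h2 : R) (y1 y2 : pt) :
  is_height Q H -> h1 <= h2 -> vertex_level H h1 y1 -> vertex_level H h2 y2 ->
  Z.Even (uc y1) -> Z.Even (uc y2) -> xc y1 = xc y2 -> (tc y1 <= tc y2)%Z.
Proof.
  intros HH Hh V1 V2 [a Ea] [b Eb] Ex.
  pose proof (vertex_level_cmp Q H h1 h2 _ _ HH Hh V1 V2) as N.
  unfold clamp, uc, vc in *; lia.
Qed.

Lemma level_succeq (Q : rect) (H : Z -> Z -> R) (h1 h2 : R) (l1 l2 : trace) :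
  even_rect Q -> is_height Q H -> inC Q l1 -> inC Q l2 ->
  at_level H l1 h1 -> at_level H l2 h2 -> h1 <= h2 -> succeq l2 l1.
Proof.
  intros HQ HH C1 C2 L1 L2 Hh.
  pose proof (proj1 (proj1 C1)) as T1; pose proof (proj1 (proj1 C2)) as T2.
  assert (V1 : forall i, (i <= tlen l1)%nat -> vertex_level H h1 (vert l1 i))
    by (intros; eapply at_level_vertex; eauto).
  assert (V2 : forall i, (i <= tlen l2)%nat -> vertex_level H h2 (vert l2 i))
    by (intros; eapply at_level_vertex; eauto).
  assert (Hcommon : forall x, inD l2 x -> inD l1 x -> (Defs.tl l2 x >= Defs.tl l1 x)%Z).
  { intros x D2 D1; apply inD_vert in D2, D1; auto.
    destruct D1 as [i [Hi <-]], D2 as [j [Hj Ej]].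
    rewrite (tl_vert l1) by assumption; rewrite <- Ej, (tl_vert l2) by assumption.
    apply Z.le_ge; eapply same_x_level; eauto using trace_even. }
  split; [exact Hcommon|].
  destruct (excluded_middle_informative (exists x, inD l2 x /\ inD l1 x)) as [[x [D2 D1]]|Hno].
  { exists x, x; auto. }
  pose proof (inD_range l1) as R1; pose proof (inD_range l2) as R2.
  assert (In1 : forall i, (i <= tlen l1)%nat -> inD l1 (xc (vert l1 i)))
    by (intros; apply inD_vert; eauto).
  assert (In2 : forall i, (i <= tlen l2)%nat -> inD l2 (xc (vert l2 i)))
    by (intros; apply inD_vert; eauto).
  destruct (inC_end Q l1 HQ C1) as [_ E1]; destruct (inC_start Q l1 HQ C1) as [_ S1].
  destruct (inC_end Q l2 HQ C2) as [_ E2]; destruct (inC_start Q l2 HQ C2) as [_ S2].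
  assert (E : forall y, (uc y - vc y = 2 * xc y /\ uc y + vc y = 2 * tc y)%Z)
    by (intro; unfold uc, vc; lia).
  assert (N : forall i j, (i <= tlen l1)%nat -> (j <= tlen l2)%nat -> ~
     ((clamp (ra Q - 2) (rb Q) (uc (vert l2 j)) <= clamp (ra Q - 2) (rb Q) (uc (vert l1 i) - 2))%Z /\
     (clamp (rc Q - 2) (rd Q) (vc (vert l2 j)) <= clamp (rc Q - 2) (rd Q) (vc (vert l1 i) - 2))%Z))
    by (intros; eapply vertex_level_cmp; eauto).
  pose proof HQ as (_ & _ & _ & _ & Hab & Hcd).
  assert (Hsep : (xc (vert l2 (tlen l2)) < xc (vert l1 0) \/
                  xc (vert l1 (tlen l1)) < xc (vert l2 0))%Z).
  { pose proof (vert_xc l1 _ T1 (le_n _)); pose proof (vert_xc l2 _ T2 (le_n _)).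
    destruct (Z_lt_le_dec (xc (vert l2 (tlen l2))) (xc (vert l1 0))); [auto|].
    destruct (Z_lt_le_dec (xc (vert l1 (tlen l1))) (xc (vert l2 0))); [auto|].
    exfalso; apply Hno; exists (Z.max (xc (vert l1 0)) (xc (vert l2 0))).
    rewrite R1, R2 by assumption; lia. }
  (* Without a common [x] the witnesses are the two endpoints that face each other. They lie on
     known sides of the rectangle, and [N] then orders their [t] coordinates. *)
  destruct Hsep as [Hs|Hs].
  - exists (xc (vert l2 (tlen l2))), (xc (vert l1 0)).
    rewrite !tl_vert by (assumption || lia).
    split; [auto|split; [apply In1; lia|]].
    specialize (N 0%nat (tlen l2) ltac:(lia) ltac:(lia)).
    pose proof (E (vert l2 (tlen l2))); pose proof (E (vert l1 0)).
    unfold clamp in N; lia.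
  - exists (xc (vert l2 0)), (xc (vert l1 (tlen l1))).
    rewrite !tl_vert by (assumption || lia).
    split; [apply In2; lia|split; [auto|]].
    specialize (N (tlen l1) 0%nat ltac:(lia) ltac:(lia)).
    pose proof (E (vert l1 (tlen l1))); pose proof (E (vert l2 0)).
    unfold clamp in N; lia.
Qed.

Lemma level_same_vertex (Q : rect) (H : Z -> Z -> R) (h : R) (l l' : trace) (i j : nat) :
  is_height Q H -> is_trace l -> is_trace l' -> at_level H l h -> at_level H l' h ->
  (i <= tlen l)%nat -> (j <= tlen l')%nat -> xc (vert l i) = xc (vert l' j) ->
  vert l i = vert l' j.
Proof.
  intros HH Hl Hl' L L' Hi Hj Ex.
  assert (tc (vert l i) = tc (vert l' j)).
  { apply Z.le_antisymm; [apply (same_x_level Q H h h)|apply (same_x_level Q H h h)];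
      eauto using at_level_vertex, trace_even, Rle_refl. }
  destruct (vert l i), (vert l' j); unfold tc, xc in *; simpl in *; congruence.
Qed.

(** The ranges of [x] overlap by [start_before_end]. If [l] started strictly to the left of [l'], it
    would run through the start of [l'] at an interior index, so a boundary point would lie in the
    domain. The ends are treated alike. *)
Lemma level_start_le (Q : rect) (H : Z -> Z -> R) (h : R) (l l' : trace) :
  even_rect Q -> is_height Q H -> inC Q l -> inC Q l' ->
  at_level H l h -> at_level H l' h ->
  (xc (vert l' 0) <= xc (vert l 0) /\ xc (vert l (tlen l)) <= xc (vert l' (tlen l')))%Z.
Proof.
  intros HQ HH C C' L L'.
  pose proof (start_before_end Q H h l l' HQ HH C C' L L') as B.
  pose proof (proj1 (proj1 C)) as T; pose proof (proj1 (proj1 C')) as T'.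
  pose proof (vert_xc l _ T (le_n _)) as X; pose proof (vert_xc l' _ T' (le_n _)) as X'.
  split; apply Z.nlt_ge; intros Hlt.
  - set (i := Z.to_nat (xc (vert l' 0) - xc (vert l 0))).
    assert (Hi : (0 < i < tlen l)%nat) by lia.
    assert (E : vert l i = vert l' 0).
    { apply (level_same_vertex Q H h); auto; try lia.
      rewrite vert_xc by (assumption || lia); lia. }
    apply (proj2 (proj1 (proj2 C'))); rewrite <- E.
    apply (proj1 C); exact Hi.
  - set (i := Z.to_nat (xc (vert l' (tlen l')) - xc (vert l 0))).
    pose proof (start_before_end Q H h l' l HQ HH C' C L' L) as B'.
    assert (Hi : (0 < i < tlen l)%nat) by lia.
    assert (E : vert l i = vert l' (tlen l')).
    { apply (level_same_vertex Q H h); auto; try lia.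
      rewrite vert_xc by (assumption || lia); lia. }
    apply (proj2 (proj2 (proj2 C'))); rewrite <- E.
    apply (proj1 C); exact Hi.
Qed.

Lemma level_unique (Q : rect) (H : Z -> Z -> R) (h : R) (l l' : trace) :
  even_rect Q -> is_height Q H -> inC Q l -> inC Q l' ->
  at_level H l h -> at_level H l' h -> l = l'.
Proof.
  intros HQ HH C C' L L'.
  pose proof (level_start_le Q H h l l' HQ HH C C' L L').
  pose proof (level_start_le Q H h l' l HQ HH C' C L' L).
  pose proof (proj1 (proj1 C)) as T; pose proof (proj1 (proj1 C')) as T'.
  pose proof (vert_xc l _ T (le_n _)) as X; pose proof (vert_xc l' _ T' (le_n _)) as X'.
  pose proof (length_tlen l T); pose proof (length_tlen l' T').
  apply nth_ext with (0%Z, 0%Z) (0%Z, 0%Z); [lia|].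
  intros n Hn; apply (level_same_vertex Q H h); auto; try lia.
  fold (vert l n) (vert l' n).
  rewrite (vert_xc l n), (vert_xc l' n) by (assumption || lia); lia.
Qed.

(** * Extension to a crossing of the domain *)

Lemma vert_app_l (l r : trace) (i : nat) : (i < length l)%nat -> vert (l ++ r) i = vert l i.
Proof. intros; apply app_nth1; assumption. Qed.

Lemma vert_snoc (l : trace) (z : pt) : vert (l ++ [z]) (length l) = z.
Proof. unfold vert; rewrite app_nth2, Nat.sub_diag by lia; reflexivity. Qed.

Lemma sub_Sbar_edge_S (Q : rect) (l : trace) : sub_Sbar Q l -> inS Q (vert l 0) \/ inS Q (vert l 1).
Proof.
  intros (Hl & _ & _ & _ & HE); apply (tedge_inE Q l 0); auto using tlen_pos.
Qed.

Lemma inSbar_step (Q : rect) (y z : pt) :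
  inS Q y -> step_up y z \/ step_down y z \/ step_up z y \/ step_down z y -> inSbar Q z.
Proof.
  intros Hy Hs; right; exists y; split; [exact Hy|]; apply adjacent_uv.
  unfold step_up, step_down in Hs; lia.
Qed.

Lemma snoc_trace (Q : rect) (H : Z -> Z -> R) (h : R) (l : trace) (z : pt) :
  sub_Sbar Q l -> at_level H l h -> inS Q (vert l (tlen l)) ->
  step_up (vert l (tlen l)) z \/ step_down (vert l (tlen l)) z ->
  edge_level H h (mkedge (vert l (tlen l)) z) ->
  sub_Sbar Q (l ++ [z]) /\ at_level H (l ++ [z]) h.
Proof.
  intros Hsub Hlev Hn Hz He; pose proof Hsub as (Hl & H0 & _ & Hi & _).
  pose proof (length_tlen l Hl) as Hlen; pose proof (tlen_pos l Hl) as Hp.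
  assert (Ht : tlen (l ++ [z]) = S (tlen l))
    by (unfold tlen at 1; rewrite length_app; simpl; lia).
  assert (Hv : forall i, (i <= tlen l)%nat -> vert (l ++ [z]) i = vert l i)
    by (intros; apply vert_app_l; lia).
  assert (Hvz : vert (l ++ [z]) (S (tlen l)) = z)
    by (rewrite <- Hlen; apply vert_snoc).
  split.
  - apply sub_Sbar_intro.
    + apply is_trace_steps; [rewrite length_app; simpl; lia| |].
      * rewrite Hv by lia; apply trace_even; [exact Hl|lia].
      * intros k; rewrite Ht; intros Hk.
        destruct (Nat.eq_dec k (tlen l)) as [->|Hne].
        -- rewrite Hvz, Hv by lia; exact Hz.
        -- rewrite !Hv by lia; apply trace_step; [exact Hl|lia].
    + rewrite Hv by lia; exact H0.
    + rewrite Ht, Hvz; apply (inSbar_step Q (vert l (tlen l))); tauto.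
    + rewrite Ht; intros i Hik; rewrite Hv by lia.
      destruct (Nat.eq_dec i (tlen l)) as [->|]; [exact Hn|apply Hi; lia].
    + rewrite !Hv by lia; apply sub_Sbar_edge_S; exact Hsub.
  - intros k; rewrite Ht; intros Hk; unfold tedge.
    destruct (Nat.eq_dec k (tlen l)) as [->|Hne].
    + rewrite Hvz, Hv by lia; exact He.
    + rewrite !Hv by lia; apply Hlev; lia.
Qed.

Lemma cons_trace (Q : rect) (H : Z -> Z -> R) (h : R) (l : trace) (z : pt) :
  sub_Sbar Q l -> at_level H l h -> inS Q (vert l 0) ->
  step_up z (vert l 0) \/ step_down z (vert l 0) ->
  edge_level H h (mkedge z (vert l 0)) ->
  sub_Sbar Q (z :: l) /\ at_level H (z :: l) h.
Proof.
  intros Hsub Hlev Hn Hz He; pose proof Hsub as (Hl & H0 & He' & Hi & _).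
  pose proof (length_tlen l Hl) as Hlen; pose proof (tlen_pos l Hl) as Hp.
  assert (Ht : tlen (z :: l) = S (tlen l)) by (unfold tlen at 1; simpl; lia).
  split.
  - apply sub_Sbar_intro.
    + apply is_trace_steps; [simpl; lia| |].
      * change (vert (z :: l) 0) with z.
        destruct (trace_even l 0 Hl ltac:(lia)) as [m Hm].
        destruct Hz as [[E _]|[E _]]; [exists (m - 1)%Z|exists m]; lia.
      * intros k; rewrite Ht; intros Hk.
        destruct k as [|k]; [exact Hz|].
        change (step_up (vert l k) (vert l (S k)) \/ step_down (vert l k) (vert l (S k))).
        apply trace_step; [exact Hl|lia].
    + apply (inSbar_step Q (vert l 0)); [exact Hn|]; change (vert (z :: l) 0) with z; tauto.
    + rewrite Ht; exact He'.
    + rewrite Ht; intros [|i] Hik; [lia|].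
      change (inS Q (vert l i)).
      destruct (Nat.eq_dec i 0) as [->|]; [exact Hn|apply Hi; lia].
    + right; exact Hn.
  - intros k; rewrite Ht; intros Hk.
    destruct k as [|k]; [exact He|].
    apply (Hlev k); lia.
Qed.

Definition pt_uv (u v : Z) : pt := ((u + v) / 2, (u - v) / 2)%Z.

Lemma uc_pt_uv (u v : Z) : Z.Even u -> Z.Even v -> uc (pt_uv u v) = u.
Proof.
  intros [a ->] [b ->]; unfold uc, pt_uv, tc, xc; cbn [fst snd].
  replace (2 * a + 2 * b)%Z with ((a + b) * 2)%Z by lia.
  replace (2 * a - 2 * b)%Z with ((a - b) * 2)%Z by lia.
  rewrite !Z.div_mul by lia; lia.
Qed.

Lemma vc_pt_uv (u v : Z) : Z.Even u -> Z.Even v -> vc (pt_uv u v) = v.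
Proof.
  intros [a ->] [b ->]; unfold vc, pt_uv, tc, xc; cbn [fst snd].
  replace (2 * a + 2 * b)%Z with ((a + b) * 2)%Z by lia.
  replace (2 * a - 2 * b)%Z with ((a - b) * 2)%Z by lia.
  rewrite !Z.div_mul by lia; lia.
Qed.

(** The face [H u (v - 2)] separates the two edges leaving [y] towards larger [x]; comparing [h]
    with its height selects the one that the level crosses. The fuel [n] suffices because each step
    raises [x] by 1 and [2 x = u - v] is at most [rb - rc + 4] on the closure. *)
Lemma extend_right (Q : rect) (H : Z -> Z -> R) (h : R) (n : nat) :
  is_height Q H -> forall l, sub_Sbar Q l -> at_level H l h ->
  (rb Q - rc Q + 4 - 2 * xc (vert l (tlen l)) < Z.of_nat n)%Z ->
  exists r, sub_Sbar Q (l ++ r) /\ at_level H (l ++ r) h /\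
            inBd Q (vert (l ++ r) (tlen (l ++ r))).
Proof.
  intros HH; induction n as [|n IH]; intros l Hsub Hlev Hn.
  - pose proof (sub_Sbar_bounds Q l (tlen l) Hsub (le_n _)).
    unfold uc, vc in *; lia.
  - destruct (excluded_middle_informative (inS Q (vert l (tlen l)))) as [Hin|Hout].
    + pose proof Hsub as (Hl & _).
      pose proof (at_level_vertex Q H h l _ HH Hl Hlev (le_n _)) as [V1 V2].
      set (y := vert l (tlen l)) in *.
      set (z := (if Rle_dec h (H (uc y) (vc y - 2)%Z)
                then ((tc y - 1)%Z, (xc y + 1)%Z) else ((tc y + 1)%Z, (xc y + 1)%Z)) : pt).
      assert (Hz : (step_up y z \/ step_down y z) /\ edge_level H h (mkedge y z)
                   /\ xc z = (xc y + 1)%Z).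
      { unfold z; destruct Rle_dec as [Hle|Hgt].
        - assert (Hs : step_down y ((tc y - 1)%Z, (xc y + 1)%Z))
            by (unfold step_down, uc, vc; simpl; lia).
          split; [auto|split; [|reflexivity]]; apply edge_level_down; auto.
        - assert (Hs : step_up y ((tc y + 1)%Z, (xc y + 1)%Z))
            by (unfold step_up, uc, vc; simpl; lia).
          split; [auto|split; [|reflexivity]]; apply edge_level_up; auto.
          split; [lra|exact V2]. }
      destruct Hz as (Hz & He & Hx).
      destruct (snoc_trace Q H h l z Hsub Hlev Hin Hz He) as [Hsub' Hlev'].
      destruct (IH _ Hsub' Hlev') as (r & R1 & R2 & R3).
      * assert (Ht : tlen (l ++ [z]) = length l)
          by (unfold tlen; rewrite length_app; simpl; lia).
        rewrite Ht, vert_snoc, Hx; lia.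
      * exists (z :: r).
        replace (l ++ z :: r) with ((l ++ [z]) ++ r) by (rewrite <- app_assoc; reflexivity).
        auto.
    + exists []; rewrite app_nil_r; split; [exact Hsub|split; [exact Hlev|]].
      split; [apply Hsub|exact Hout].
Qed.

(** Mirror image of [extend_right]: the deciding face is now [H (u - 2) v], between the two edges
    arriving at [y] from smaller [x]. *)
Lemma extend_left (Q : rect) (H : Z -> Z -> R) (h : R) (n : nat) :
  is_height Q H -> forall l, sub_Sbar Q l -> at_level H l h ->
  (2 * xc (vert l 0) - (ra Q - rd Q - 4) < Z.of_nat n)%Z ->
  exists r, sub_Sbar Q (r ++ l) /\ at_level H (r ++ l) h /\ inBd Q (vert (r ++ l) 0).
Proof.
  intros HH; induction n as [|n IH]; intros l Hsub Hlev Hn.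
  - pose proof (sub_Sbar_bounds Q l 0 Hsub ltac:(lia)).
    unfold uc, vc in *; lia.
  - destruct (excluded_middle_informative (inS Q (vert l 0))) as [Hin|Hout].
    + pose proof Hsub as (Hl & _).
      pose proof (at_level_vertex Q H h l 0 HH Hl Hlev ltac:(lia)) as [V1 V2].
      set (y := vert l 0) in *.
      set (z := (if Rle_dec h (H (uc y - 2)%Z (vc y))
                then ((tc y - 1)%Z, (xc y - 1)%Z) else ((tc y + 1)%Z, (xc y - 1)%Z)) : pt).
      assert (Hz : (step_up z y \/ step_down z y) /\ edge_level H h (mkedge z y)
                   /\ xc z = (xc y - 1)%Z).
      { unfold z; destruct Rle_dec as [Hle|Hgt].
        - assert (Hs : step_up ((tc y - 1)%Z, (xc y - 1)%Z) y)
            by (unfold step_up, uc, vc; simpl; lia).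
          split; [auto|split; [|reflexivity]]; apply (edge_level_up H h _ _ Hs).
          destruct Hs as [-> ->] in V1, Hle.
          replace (uc ((tc y - 1)%Z, (xc y - 1)%Z) + 2 - 2)%Z
            with (uc ((tc y - 1)%Z, (xc y - 1)%Z)) in * by lia; auto.
        - assert (Hs : step_down ((tc y + 1)%Z, (xc y - 1)%Z) y)
            by (unfold step_down, uc, vc; simpl; lia).
          split; [auto|split; [|reflexivity]]; apply (edge_level_down H h _ _ Hs).
          destruct Hs as [E1 E2]; rewrite <- E1, <- E2.
          split; [|exact V2].
          lra. }
      destruct Hz as (Hz & He & Hx).
      destruct (cons_trace Q H h l z Hsub Hlev Hin Hz He) as [Hsub' Hlev'].
      destruct (IH _ Hsub' Hlev') as (r & R1 & R2 & R3).
      * change (vert (z :: l) 0) with z; rewrite Hx; lia.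
      * exists (r ++ [z]); rewrite <- app_assoc; auto.
    + exists []; simpl; split; [exact Hsub|split; [exact Hlev|]].
      split; [apply Hsub|exact Hout].
Qed.

Lemma extend_to_C (Q : rect) (H : Z -> Z -> R) (h : R) (l : trace) :
  is_height Q H -> sub_Sbar Q l -> at_level H l h ->
  exists l', inC Q l' /\ at_level H l' h /\ incl l l'.
Proof.
  intros HH Hsub Hlev.
  destruct (extend_right Q H h (Z.to_nat (rb Q - rc Q + 5 - 2 * xc (vert l (tlen l)))) HH l)
    as (r & R1 & R2 & R3); auto; [lia|].
  set (m := l ++ r) in *.
  destruct (extend_left Q H h (Z.to_nat (2 * xc (vert m 0) - (ra Q - rd Q - 5))) HH m)
    as (s & S1 & S2 & S3); auto; [lia|].
  exists (s ++ m); split; [|split; [exact S2|]].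
  - split; [exact S1|split; [exact S3|]].
    replace (vert (s ++ m) (tlen (s ++ m))) with (vert m (tlen m)); [exact R3|].
    pose proof (length_tlen m (proj1 R1)).
    unfold vert, tlen; rewrite length_app.
    rewrite app_nth2 by lia; f_equal; lia.
  - apply incl_appr, incl_appl, incl_refl.
Qed.

(** * The later side of a trace *)

(* [(u, v)] indexes a face as in [is_height]: the face is centred one unit of [t] after
   the vertex with these coordinates. *)
Definition later_side (l : trace) (u v : Z) : Prop :=
  exists y, In y l /\ (uc y <= u)%Z /\ (vc y <= v)%Z.

(** Along a trace [u] never decreases and [v] never increases. So the vertices up to index [k] have
    too large a [v], and the following ones too large a [u], to reach the face on the earlier side
    of the edge. *)
Lemma later_side_edge (l : trace) (k : nat) : is_trace l -> (k < tlen l)%nat ->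
  let e := tedge l k in
  later_side l (uc (e_lo e)) (vc (e_lo e)) /\
  ~ (if snd e then later_side l (uc (e_lo e)) (vc (e_lo e) - 2)
     else later_side l (uc (e_lo e) - 2) (vc (e_lo e))).
Proof.
  intros Hl Hk e; unfold e, tedge.
  assert (In0 : forall i, (i <= tlen l)%nat -> In (vert l i) l)
    by (intros; apply In_vert; eauto).
  assert (Hord : forall y, In y l ->
    (uc y <= uc (vert l k) /\ vc (vert l k) <= vc y)%Z \/
    (uc (vert l (S k)) <= uc y /\ vc y <= vc (vert l (S k)))%Z).
  { intros y Hy; apply In_vert in Hy; auto; destruct Hy as [i [Hi <-]].
    destruct (Nat.le_gt_cases i k); [left|right]; apply trace_mono; auto; lia. }
  destruct (trace_step l k Hl Hk) as [Hs|Hs].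
  - rewrite (mkedge_up _ _ Hs); destruct Hs as [E1 E2]; unfold e_lo; simpl; split.
    + exists (vert l k); split; [apply In0; lia|lia].
    + intros [y [Hy Hc]]; specialize (Hord y Hy); lia.
  - rewrite (mkedge_down _ _ Hs); destruct Hs as [E1 E2]; unfold e_lo; simpl; split.
    + exists (vert l (S k)); split; [apply In0; lia|lia].
    + intros [y [Hy Hc]]; specialize (Hord y Hy); lia.
Qed.

(** The vertex [y] of [l'] that puts [(u, v)] on the later side is compared with the vertex of [l]
    at the same [x], or, if [l] has none there, with the nearer end of [l]. The ranges of [u] and
    [v] make the side on which that end lies usable. *)
Lemma later_side_incl (Q : rect) (l l' : trace) (u v : Z) :
  even_rect Q -> inC Q l -> inC Q l' -> succeq l' l ->
  (ra Q - 2 <= u <= rb Q)%Z -> (rc Q - 2 <= v <= rd Q)%Z ->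
  later_side l' u v -> later_side l u v.
Proof.
  intros HQ C C' [Hcom [x2 [x1 [D2 [D1 Hx]]]]] Hu Hv [y [Hy [Hyu Hyv]]].
  pose proof (proj1 (proj1 C)) as T; pose proof (proj1 (proj1 C')) as T'.
  apply In_vert in Hy; auto; destruct Hy as [i [Hi Ei]].
  destruct (excluded_middle_informative (later_side l u v)) as [|Hnot]; [assumption|exfalso].
  assert (Hno : forall k, (k <= tlen l)%nat -> (u < uc (vert l k) \/ v < vc (vert l k))%Z).
  { intros k Hk; apply NNPP; intros Hc; apply Hnot; exists (vert l k).
    split; [apply In_vert; eauto|lia]. }
  pose proof (vert_xc l _ T (le_n _)) as X; pose proof (vert_xc l' _ T' (le_n _)) as X'.
  assert (Hsame : forall j k, (j <= tlen l')%nat -> (k <= tlen l)%nat ->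
    xc (vert l' j) = xc (vert l k) -> (tc (vert l k) <= tc (vert l' j))%Z).
  { intros j k Hj Hk Ex.
    specialize (Hcom (xc (vert l k))).
    rewrite tl_vert in Hcom by assumption; rewrite <- Ex, tl_vert in Hcom by assumption.
    apply Z.ge_le, Hcom; apply inD_vert; eauto. }
  apply inD_vert in D1, D2; auto.
  destruct D1 as [k1 [Hk1 <-]], D2 as [k2 [Hk2 <-]].
  rewrite !tl_vert in Hx by assumption.
  pose proof (trace_mono l 0 k1 T ltac:(lia) Hk1) as M1.
  pose proof (trace_mono l k1 (tlen l) T Hk1 (le_n _)) as M2.
  pose proof (trace_mono l' 0 k2 T' ltac:(lia) Hk2) as M1'.
  pose proof (trace_mono l' k2 (tlen l') T' Hk2 (le_n _)) as M2'.
  pose proof (sub_Sbar_bounds Q l k1 (proj1 C) Hk1) as B1.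
  pose proof (sub_Sbar_bounds Q l' k2 (proj1 C') Hk2) as B2.
  pose proof (sub_Sbar_bounds Q l' i (proj1 C') Hi) as Bi; rewrite Ei in Bi.
  destruct (inC_end Q l HQ C) as [_ E1]; destruct (inC_start Q l HQ C) as [_ S1].
  destruct (inC_end Q l' HQ C') as [_ E2]; destruct (inC_start Q l' HQ C') as [_ S2].
  pose proof (Hno 0%nat ltac:(lia)) as N0; pose proof (Hno (tlen l) (le_n _)) as Nn.
  assert (UV : forall y, (uc y - vc y = 2 * xc y /\ uc y + vc y = 2 * tc y)%Z)
    by (intro; unfold uc, vc; lia).
  pose proof (UV y) as UVy; pose proof (UV (vert l 0)) as UV0; pose proof (UV (vert l (tlen l))) as UVn.
  pose proof (UV (vert l' 0)) as UV0'; pose proof (UV (vert l' (tlen l'))) as UVn'.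
  pose proof (UV (vert l k1)) as UVk1; pose proof (UV (vert l' k2)) as UVk2.
  pose proof (vert_xc l' i T' Hi) as Xi; rewrite Ei in Xi.
  destruct HQ as (_ & _ & _ & _ & Hab & Hcd).
  destruct (Z_lt_le_dec (xc y) (xc (vert l 0))) as [Hlt|Hge].
  (* If [l'] ends before [l] starts there is no common [x], and [Hx], the comparison of one vertex
     of each trace, takes over. *)
  - destruct (Z_lt_le_dec (xc (vert l' (tlen l'))) (xc (vert l 0))) as [Hsep|Hov].
    + clear Hsame Hcom Hno; lia.
    + set (j := Z.to_nat (xc (vert l 0) - xc (vert l' 0))).
      assert (Hj : (i <= j <= tlen l')%nat) by lia.
      pose proof (vert_xc l' j T' ltac:(lia)) as Xj.
      pose proof (Hsame j 0%nat ltac:(lia) ltac:(lia) ltac:(lia)) as Hc.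
      pose proof (trace_mono l' i j T' ltac:(lia) ltac:(lia)) as M; rewrite Ei in M.
      pose proof (UV (vert l' j)) as UVj.
      clear Hsame Hcom Hno; lia.
  - destruct (Z_lt_le_dec (xc (vert l (tlen l))) (xc y)) as [Hlt|Hle].
    + destruct (Z_lt_le_dec (xc (vert l (tlen l))) (xc (vert l' 0))) as [Hsep|Hov].
      * clear Hsame Hcom Hno; lia.
      * set (j := Z.to_nat (xc (vert l (tlen l)) - xc (vert l' 0))).
        assert (Hj : (j <= i)%nat) by lia.
        pose proof (vert_xc l' j T' ltac:(lia)) as Xj.
        pose proof (Hsame j (tlen l) ltac:(lia) ltac:(lia) ltac:(lia)) as Hc.
        pose proof (trace_mono l' j i T' ltac:(lia) ltac:(lia)) as M; rewrite Ei in M.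
        pose proof (UV (vert l' j)) as UVj.
        clear Hsame Hcom Hno; lia.
    + set (j := Z.to_nat (xc y - xc (vert l 0))).
      assert (Hj : (j <= tlen l)%nat) by lia.
      pose proof (vert_xc l j T ltac:(lia)) as Xj.
      pose proof (Hsame i j Hi Hj ltac:(rewrite Ei; lia)) as Hc; rewrite Ei in Hc.
      pose proof (Hno j Hj) as Nj.
      pose proof (UV (vert l j)) as UVj.
      clear Hsame Hcom Hno; lia.
Qed.

(** * Weights as lengths of level intervals *)

(** The height intervals of [eSW] and [eSE], stacked in this order, fill the interval from the
    earliest to the latest face around [y]; those of [eNW] and [eNE] fill the same interval. *)
Lemma star_early_late (H : Z -> Z -> R) (y : pt) :
  early H (eSW y) = H (uc y - 2)%Z (vc y - 2)%Z /\ late H (eSW y) = H (uc y - 2)%Z (vc y) /\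
  early H (eSE y) = H (uc y - 2)%Z (vc y) /\ late H (eSE y) = H (uc y) (vc y) /\
  early H (eNW y) = H (uc y - 2)%Z (vc y - 2)%Z /\ late H (eNW y) = H (uc y) (vc y - 2)%Z /\
  early H (eNE y) = H (uc y) (vc y - 2)%Z /\ late H (eNE y) = H (uc y) (vc y).
Proof.
  unfold early, late, eSW, eSE, eNW, eNE, e_lo, uc, vc, tc, xc; cbn [fst snd].
  repeat split; f_equal; lia.
Qed.

Lemma star_inE (Q : rect) (y : pt) : inS Q y ->
  inE Q (eSW y) /\ inE Q (eSE y) /\ inE Q (eNW y) /\ inE Q (eNE y).
Proof.
  intros Hy; unfold inE.
  replace (e_hi (eSW y)) with y by (apply pt_eq; unfold e_hi, eSW, uc, vc, tc, xc; simpl; lia).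
  replace (e_hi (eNW y)) with y by (apply pt_eq; unfold e_hi, eNW, uc, vc, tc, xc; simpl; lia).
  unfold e_lo, eSE, eNE; simpl; tauto.
Qed.

Lemma star_height (Q : rect) (eta : edge -> R) (H : Z -> Z -> R) (y : pt) :
  is_potential Q eta H -> inS Q y ->
  eta (eSW y) = late H (eSW y) - early H (eSW y) /\
  eta (eSE y) = late H (eSE y) - early H (eSE y) /\
  eta (eNW y) = late H (eNW y) - early H (eNW y) /\
  eta (eNE y) = late H (eNE y) - early H (eNE y).
Proof.
  intros [_ HE] Hy; destruct (star_inE Q y Hy) as (? & ? & ? & ?); auto.
Qed.

(** The four cases of [assoc] are the four ways in which a lower and an upper piece of the two
    stacks can share a height. In the last one both pieces end at the top, so distances from the top
    agree, and the common part has length [birth eta y]. *)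
Lemma assoc_height (Q : rect) (eta : edge -> R) (H : Z -> Z -> R) (y : pt) (f1 f2 : edge) (p1 p2 : R) :
  is_potential Q eta H -> inS Q y ->
  f1 = eSW y \/ f1 = eSE y -> f2 = eNW y \/ f2 = eNE y ->
  (assoc eta y f1 p1 f2 p2 <->
   0 < p1 <= eta f1 /\ 0 < p2 <= eta f2 /\ p1 + early H f1 = p2 + early H f2).
Proof.
  intros HP Hy H1 H2.
  destruct (star_height Q eta H y HP Hy) as (ESW & ESE & ENW & ENE).
  destruct (star_early_late H y) as (A1 & A2 & A3 & A4 & A5 & A6 & A7 & A8).
  assert (D1 : eSW y <> eSE y) by (unfold eSW, eSE; congruence).
  assert (D2 : eNW y <> eNE y) by (unfold eNW, eNE; congruence).
  unfold assoc, birth; split.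
  - intros (_ & P1 & _ & P2 & Hc); split; [exact P1|split; [exact P2|]].
    destruct Hc as [(-> & -> & _ & ->)|[(-> & -> & _ & ->)|[(-> & -> & _ & ->)|(-> & -> & _ & _ & E)]]]; lra.
  - intros (P1 & P2 & E); split; [exact H1|split; [exact P1|split; [exact H2|split; [exact P2|]]]].
    destruct H1 as [->| ->], H2 as [->| ->].
    + left; repeat split; try lra; apply Rmin_glb; lra.
    + right; right; left; repeat split; lra.
    + right; left; repeat split; lra.
    + right; right; right; repeat split; try lra; unfold Rmin; destruct Rle_dec; lra.
Qed.

Lemma tedge_around (l : trace) (k : nat) : is_trace l -> (S k < tlen l)%nat ->
  (tedge l k = eSW (vert l (S k)) \/ tedge l k = eSE (vert l (S k))) /\
  (tedge l (S k) = eNW (vert l (S k)) \/ tedge l (S k) = eNE (vert l (S k))).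
Proof.
  intros Hl Hk; split; unfold tedge.
  - destruct (trace_step l k Hl ltac:(lia)) as [Hs|Hs].
    + left; rewrite (mkedge_up _ _ Hs); unfold eSW; f_equal.
      destruct Hs; apply pt_eq; unfold uc, vc in *; simpl; lia.
    + right; rewrite (mkedge_down _ _ Hs); reflexivity.
  - destruct (trace_step l (S k) Hl ltac:(lia)) as [Hs|Hs].
    + right; rewrite (mkedge_up _ _ Hs); reflexivity.
    + left; rewrite (mkedge_down _ _ Hs); unfold eNW; f_equal.
      destruct Hs; apply pt_eq; unfold uc, vc in *; simpl; lia.
Qed.

Lemma weight_set_level (Q : rect) (eta : edge -> R) (H : Z -> Z -> R) (l : trace) (p : R) :
  is_potential Q eta H -> sub_Sbar Q l ->
  (weight_set eta l p <-> at_level H l (p + early H (tedge l 0))).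
Proof.
  intros HP (Hl & _ & _ & Hi & HE).
  pose proof (tlen_pos l Hl) as Hp.
  assert (Heta : forall k, (k < tlen l)%nat ->
    eta (tedge l k) = late H (tedge l k) - early H (tedge l k))
    by (intros k Hk; apply (proj2 HP), HE, Hk).
  assert (Has : forall k p1 p2, (S k < tlen l)%nat ->
    (assoc eta (vert l (S k)) (tedge l k) p1 (tedge l (S k)) p2 <->
     0 < p1 <= eta (tedge l k) /\ 0 < p2 <= eta (tedge l (S k)) /\
     p1 + early H (tedge l k) = p2 + early H (tedge l (S k)))).
  { intros k p1 p2 Hk; destruct (tedge_around l k Hl Hk).
    apply (assoc_height Q); auto; apply Hi; lia. }
  split.
  - intros [_ (ps & <- & Hps & Hass)].
    assert (Heq : forall k, (k < tlen l)%nat -> ps k + early H (tedge l k) = ps 0%nat + early H (tedge l 0)).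
    { induction k as [|k IH]; intros Hk; [reflexivity|].
      specialize (Hass k Hk); apply Has in Hass; auto.
      rewrite <- IH by lia; lra. }
    intros k Hk; unfold edge_level; rewrite <- (Heq k Hk).
    specialize (Hps k Hk); rewrite (Heta k Hk) in Hps; lra.
  - intros Hlev.
    assert (Hr : forall k, (k < tlen l)%nat ->
      0 < p + early H (tedge l 0) - early H (tedge l k) <= eta (tedge l k)).
    { intros k Hk; rewrite (Heta k Hk); destruct (Hlev k Hk); lra. }
    split.
    + pose proof (Hr 0%nat Hp); lra.
    + exists (fun k => p + early H (tedge l 0) - early H (tedge l k)).
      split; [lra|split; [exact Hr|]].
      intros k Hk; apply Has; auto; split; [apply Hr; lia|split; [apply Hr; lia|lra]].
Qed.

Lemma weight_level_interval (Q : rect) (eta : edge -> R) (H : Z -> Z -> R) (l : trace) (lo hi : R) :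
  is_potential Q eta H -> sub_Sbar Q l -> lo <= hi ->
  (forall h, at_level H l h <-> lo < h <= hi) -> weight eta l = hi - lo.
Proof.
  intros HP Hl Hle Hlev.
  unfold weight; rewrite (lebesgue_measure_interval _
    (lo - early H (tedge l 0)) (hi - early H (tedge l 0))); [lra| |lra].
  intros p; rewrite (weight_set_level Q eta H), Hlev by assumption.
  lra.
Qed.

Lemma weight_no_level (Q : rect) (eta : edge -> R) (H : Z -> Z -> R) (l : trace) :
  is_potential Q eta H -> sub_Sbar Q l -> (forall h, ~ at_level H l h) -> weight eta l = 0.
Proof.
  intros HP Hl Hno.
  rewrite (weight_level_interval Q eta H l 0 0); auto; [lra..|].
  intros h; split; [intros Hh; destruct (Hno h Hh)|lra].
Qed.

(** [P] records where the endpoints come from. It is used with the set of heights [V m], so that an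
    intersection of edge levels again has endpoints of this form; [lo] may exceed [hi]. *)
Lemma inter_intervals (P : R -> Prop) (al be : nat -> R) (n : nat) :
  (forall k, (k <= n)%nat -> P (al k) /\ P (be k)) ->
  exists lo hi, P lo /\ P hi /\
    forall h, (forall k, (k <= n)%nat -> al k < h <= be k) <-> lo < h <= hi.
Proof.
  induction n as [|n IH]; intros HP.
  - exists (al 0%nat), (be 0%nat).
    destruct (HP 0%nat ltac:(lia)); split; [auto|split; [auto|]].
    intros h; split; [intros Hh; apply Hh; lia|intros Hh k Hk].
    replace k with 0%nat by lia; exact Hh.
  - destruct IH as (lo & hi & Plo & Phi & E); [intros; apply HP; lia|].
    destruct (HP (S n) ltac:(lia)) as [P1 P2].
    exists (Rmax lo (al (S n))), (Rmin hi (be (S n))).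
    split; [unfold Rmax; destruct Rle_dec; auto|].
    split; [unfold Rmin; destruct Rle_dec; auto|].
    intros h; split.
    + intros Hh; specialize (E h); pose proof (Hh (S n) ltac:(lia)).
      assert (lo < h <= hi) by (apply E; intros; apply Hh; lia).
      split; [apply Rmax_lub_lt|apply Rmin_glb]; lra.
    + intros [H1 H2] k Hk.
      pose proof (Rmax_l lo (al (S n))); pose proof (Rmax_r lo (al (S n))).
      pose proof (Rmin_l hi (be (S n))); pose proof (Rmin_r hi (be (S n))).
      destruct (Nat.eq_dec k (S n)) as [->|]; [lra|].
      apply E; [lra|lia].
Qed.

(** * Finite sums *)

Fixpoint psum (f : nat -> R) (n : nat) : R :=
  match n with 0%nat => 0 | S n => psum f n + f n end.

Lemma psum_ext (f g : nat -> R) (n : nat) :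
  (forall k, (k < n)%nat -> f k = g k) -> psum f n = psum g n.
Proof.
  induction n as [|n IH]; intros E; simpl; [reflexivity|].
  rewrite IH, E by auto; reflexivity.
Qed.

Lemma psum_shift (f : nat -> R) (n : nat) : psum f (S n) = f 0%nat + psum (fun k => f (S k)) n.
Proof. induction n as [|n IH]; [simpl; lra|]; simpl in *; lra. Qed.

Lemma psum_le (f g : nat -> R) (n : nat) :
  (forall k, (k < n)%nat -> f k <= g k) -> psum f n <= psum g n.
Proof.
  induction n as [|n IH]; intros E; simpl; [lra|].
  pose proof (IH ltac:(auto)); pose proof (E n ltac:(lia)); lra.
Qed.

Lemma wsum_psum (ls : list trace) (ws : list R) (f : trace -> R) :
  length ws = length ls ->
  wsum ls ws f = psum (fun k => nth k ws 0 * f (nth k ls [])) (length ls).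
Proof.
  revert ws; induction ls as [|l ls IH]; intros [|w ws] Hlen; try discriminate; [reflexivity|].
  change (wsum (l :: ls) (w :: ws) f) with (w * f l + wsum ls ws f).
  rewrite IH by (simpl in Hlen; lia).
  change (length (l :: ls)) with (S (length ls)); rewrite psum_shift; reflexivity.
Qed.

Lemma indic_true (P : Prop) : P -> indic P = 1.
Proof. intros; unfold indic; destruct excluded_middle_informative; tauto. Qed.

Lemma indic_false (P : Prop) : ~ P -> indic P = 0.
Proof. intros; unfold indic; destruct excluded_middle_informative; tauto. Qed.

Lemma indic_iff (P Q : Prop) : (P <-> Q) -> indic P = indic Q.
Proof. intros; unfold indic; repeat destruct excluded_middle_informative; tauto. Qed.

Lemma psum_telescope (V : nat -> R) (a b n : nat) : (a <= b)%nat -> (b <= n)%nat ->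
  psum (fun k => (V (S k) - V k) * indic (a <= k < b)%nat) n = V b - V a.
Proof.
  intros Hab Hbn; induction Hbn as [|n Hbn IH].
  - induction Hab as [|b Hab IH].
    + assert (E : forall m, (m <= a)%nat ->
        psum (fun k => (V (S k) - V k) * indic (a <= k < a)%nat) m = 0).
      { induction m as [|m IHm]; intros Hm; simpl; [reflexivity|].
        rewrite IHm, indic_false by lia; ring. }
      rewrite E by lia; ring.
    + simpl; rewrite (indic_true (a <= b < S b)%nat) by lia.
      rewrite (psum_ext _ (fun k => (V (S k) - V k) * indic (a <= k < b)%nat)).
      * rewrite IH; ring.
      * intros k Hk; f_equal; apply indic_iff; lia.
  - simpl; rewrite IH, indic_false by lia; ring.
Qed.

Lemma strict_chain_lt (V : nat -> R) (n i j : nat) :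
  (forall k, (k < n)%nat -> V k < V (S k)) -> (i < j)%nat -> (j <= n)%nat -> V i < V j.
Proof.
  intros HV Hij; induction Hij as [|j Hij IH]; intros Hj; [apply HV; lia|].
  apply Rlt_trans with (V j); [apply IH; lia|apply HV; lia].
Qed.

Lemma strict_chain_lt_iff (V : nat -> R) (n i j : nat) :
  (forall k, (k < n)%nat -> V k < V (S k)) -> (i <= n)%nat -> (j <= n)%nat ->
  (V i < V j <-> (i < j)%nat).
Proof.
  intros HV Hi Hj; split; [|intros; apply (strict_chain_lt V n); auto].
  intros Hlt; destruct (Nat.lt_total i j) as [|[->|Hji]]; [assumption|lra|].
  pose proof (strict_chain_lt V n j i HV Hji Hi); lra.
Qed.

Lemma strict_chain_le_iff (V : nat -> R) (n i j : nat) :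
  (forall k, (k < n)%nat -> V k < V (S k)) -> (i <= n)%nat -> (j <= n)%nat ->
  (V i <= V j <-> (i <= j)%nat).
Proof.
  intros HV Hi Hj; pose proof (strict_chain_lt_iff V n j i HV Hj Hi).
  destruct (Rle_dec (V i) (V j)); destruct (Nat.le_gt_cases i j); split; intros;
    try assumption; try lra; try lia; exfalso.
  - assert (V j < V i) by (apply H; lia); lra.
  - assert (Hn : (j < i)%nat) by (apply H; lra); lia.
Qed.

Lemma chain_locate (V : nat -> R) (n : nat) (h : R) :
  V 0%nat < h <= V n -> exists k, (k < n)%nat /\ V k < h <= V (S k).
Proof.
  induction n as [|n IH]; intros Hh; [lra|].
  destruct (Rle_dec h (V n)); [|exists n; split; [lia|lra]].
  destruct IH as (k & Hk & E); [lra|exists k; split; [lia|exact E]].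
Qed.

(** * Chains of level traces *)

(* The heights take the values [V 0 < ... < V n], and [nth k ls] is the level line
   separating the faces of height at most [V k] from those of height at least [V (k+1)]. *)
Record level_chain (Q : rect) (H : Z -> Z -> R) (V : nat -> R) (ls : list trace) : Prop := {
  chain_incr : forall k, (k < length ls)%nat -> V k < V (S k);
  chain_C : forall k, (k < length ls)%nat -> inC Q (nth k ls []);
  chain_level : forall k, (k < length ls)%nat -> at_level H (nth k ls []) (V (S k));
  chain_distinct : forall i j, (i < j < length ls)%nat -> nth i ls [] <> nth j ls [];
  chain_values : forall u v, Z.Even u -> Z.Even v -> exists m, (m <= length ls)%nat /\ H u v = V m
}.

(** Lattice points have both [u] and [v] even, so the faces beside an edge of a trace have even
    indices, the only ones that [chain_values] speaks of. *)
Lemma tedge_values (H : Z -> Z -> R) (P : R -> Prop) (l : trace) (k : nat) :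
  is_trace l -> (k < tlen l)%nat ->
  (forall u v, Z.Even u -> Z.Even v -> P (H u v)) ->
  P (early H (tedge l k)) /\ P (late H (tedge l k)).
Proof.
  intros Hl Hk HP.
  assert (Hev : forall y, Z.Even (uc y) -> Z.Even (vc y)).
  { intros y [m Hm]; exists (m - xc y)%Z; unfold uc, vc in *; lia. }
  assert (Hlo : Z.Even (uc (e_lo (tedge l k)))).
  { unfold tedge; destruct (trace_step l k Hl Hk) as [Hs|Hs].
    - rewrite (mkedge_up _ _ Hs); apply trace_even; [exact Hl|lia].
    - rewrite (mkedge_down _ _ Hs); apply trace_even; [exact Hl|lia]. }
  unfold early, late; split; [|auto].
  destruct (snd (tedge l k)); auto using even_sub2.
Qed.

Lemma chain_tedge_values (Q : rect) (H : Z -> Z -> R) (V : nat -> R) (ls : list trace)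
  (l : trace) (k : nat) :
  level_chain Q H V ls -> is_trace l -> (k < tlen l)%nat ->
  (exists m, (m <= length ls)%nat /\ early H (tedge l k) = V m) /\
  (exists m, (m <= length ls)%nat /\ late H (tedge l k) = V m).
Proof.
  intros HC Hl Hk.
  apply (tedge_values H (fun r => exists m, (m <= length ls)%nat /\ r = V m)); auto.
  apply (chain_values _ _ _ _ HC).
Qed.

Lemma incl_at_level (H : Z -> Z -> R) (h : R) (l l' : trace) :
  is_trace l -> is_trace l' -> incl l l' -> at_level H l' h -> at_level H l h.
Proof.
  intros Hl Hl' Hincl Hlev k Hk.
  assert (He : is_edge_of (tedge l k) l) by (exists k; auto).
  apply is_edge_of_In in He; [|exact Hl].
  assert (He' : is_edge_of (tedge l k) l') by (apply is_edge_of_In; [exact Hl'|]; split; apply Hincl, He).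
  destruct He' as [k' [Hk' ->]]; apply Hlev, Hk'.
Qed.

(** No edge height lies strictly inside a gap, so raising [h] to the top [V (S k)] of its gap leaves
    [l] on the level; there it must be the [k]-th trace by [level_unique]. *)
Lemma chain_C_level (Q : rect) (H : Z -> Z -> R) (V : nat -> R) (ls : list trace) (l : trace) (h : R) :
  even_rect Q -> is_height Q H -> level_chain Q H V ls -> inC Q l -> at_level H l h ->
  exists k, (k < length ls)%nat /\ V k < h <= V (S k) /\ l = nth k ls [].
Proof.
  intros HQ HH HC Hl Hlev.
  pose proof (proj1 (proj1 Hl)) as T; pose proof (tlen_pos l T) as Hp.
  pose proof (chain_tedge_values Q H V ls l 0 HC T Hp) as [(m & Hm & Em) (m' & Hm' & Em')].
  destruct (Hlev 0%nat Hp) as [L1 L2]; rewrite Em in L1; rewrite Em' in L2.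
  pose proof (chain_incr _ _ _ _ HC) as HV.
  pose proof (proj2 (strict_chain_le_iff V _ 0 m HV ltac:(lia) Hm) ltac:(lia)).
  pose proof (proj2 (strict_chain_le_iff V _ m' (length ls) HV Hm' ltac:(lia)) Hm').
  destruct (chain_locate V (length ls) h) as (k & Hk & E); [lra|].
  exists k; split; [exact Hk|split; [exact E|]].
  apply (level_unique Q H (V (S k))); auto.
  - apply (chain_C _ _ _ _ HC); exact Hk.
  - intros j Hj; pose proof (Hlev j Hj) as [J1 J2].
    pose proof (chain_tedge_values Q H V ls l j HC T Hj) as [(i & Hi & Ei) (i' & Hi' & Ei')].
    split; [lra|rewrite Ei' in *].
    apply (strict_chain_le_iff V (length ls)); auto.
    apply (strict_chain_lt_iff V (length ls)); auto; [lia|lra].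
  - apply (chain_level _ _ _ _ HC); exact Hk.
Qed.

(** Distinctness of the traces ties each to one gap. Conversely the level may be lowered from
    [V (S k)] within the gap, since an early height below [V (S k)] is at most [V k]. *)
Lemma chain_level_iff (Q : rect) (H : Z -> Z -> R) (V : nat -> R) (ls : list trace) (k : nat) (h : R) :
  even_rect Q -> is_height Q H -> level_chain Q H V ls -> (k < length ls)%nat ->
  (at_level H (nth k ls []) h <-> V k < h <= V (S k)).
Proof.
  intros HQ HH HC Hk; pose proof (chain_C _ _ _ _ HC k Hk) as Hl; split.
  - intros Hlev; destruct (chain_C_level Q H V ls _ h HQ HH HC Hl Hlev) as (j & Hj & E & Ej).
    destruct (Nat.lt_total k j) as [Hlt|[->|Hlt]]; [|exact E|].
    + destruct (chain_distinct _ _ _ _ HC k j); auto.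
    + destruct (chain_distinct _ _ _ _ HC j k); auto.
  - intros Hh j Hj.
    pose proof (chain_level _ _ _ _ HC k Hk j Hj) as [J1 J2].
    pose proof (chain_tedge_values Q H V ls _ j HC (proj1 (proj1 Hl)) Hj) as [(i & Hi & Ei) _].
    split; [rewrite Ei in *|lra].
    pose proof (chain_incr _ _ _ _ HC) as HV.
    apply (strict_chain_lt_iff V (length ls) i (S k) HV) in J1; [|exact Hi|lia].
    pose proof (proj2 (strict_chain_le_iff V (length ls) i k HV Hi ltac:(lia)) ltac:(lia)).
    lra.
Qed.

Lemma chain_weight (Q : rect) (eta : edge -> R) (H : Z -> Z -> R) (V : nat -> R) (ls : list trace) (k : nat) :
  even_rect Q -> is_potential Q eta H -> level_chain Q H V ls -> (k < length ls)%nat ->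
  weight eta (nth k ls []) = V (S k) - V k.
Proof.
  intros HQ HP HC Hk.
  apply (weight_level_interval Q eta H); auto.
  - apply (chain_C _ _ _ _ HC); exact Hk.
  - apply Rlt_le, (chain_incr _ _ _ _ HC), Hk.
  - intros h; apply (chain_level_iff Q); auto; apply HP.
Qed.

Lemma chain_weight_other (Q : rect) (eta : edge -> R) (H : Z -> Z -> R) (V : nat -> R)
  (ls : list trace) (l : trace) :
  even_rect Q -> is_potential Q eta H -> level_chain Q H V ls -> inC Q l ->
  (forall j, (j < length ls)%nat -> l <> nth j ls []) -> weight eta l = 0.
Proof.
  intros HQ HP HC Hl Hno.
  apply (weight_no_level Q eta H); auto; [apply Hl|].
  intros h Hlev; destruct (chain_C_level Q H V ls l h HQ (proj1 HP) HC Hl Hlev) as (k & Hk & _ & E).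
  exact (Hno k Hk E).
Qed.

Lemma chain_charac (Q : rect) (eta : edge -> R) (H : Z -> Z -> R) (V : nat -> R)
  (ls : list trace) (ws : list R) :
  even_rect Q -> is_potential Q eta H -> level_chain Q H V ls ->
  (forall j, (j < length ls)%nat -> nth j ws 0 = V (S j) - V j) -> charac Q eta ls ws.
Proof.
  intros HQ HP HC Hws l Hl; split.
  - intros j Hj ->; rewrite Hws by assumption; apply (chain_weight Q _ H); auto.
  - intros Hno; apply (chain_weight_other Q _ H V ls); auto.
Qed.

Lemma chain_posC (Q : rect) (eta : edge -> R) (H : Z -> Z -> R) (V : nat -> R)
  (ls : list trace) (l : trace) :
  even_rect Q -> is_potential Q eta H -> level_chain Q H V ls -> (posC Q eta l <-> In l ls).
Proof.
  intros HQ HP HC; split.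
  - intros [Hl Hw]; destruct (excluded_middle_informative (In l ls)) as [|Hno]; [assumption|].
    rewrite (chain_weight_other Q eta H V ls l) in Hw; auto; [lra|].
    intros j Hj ->; apply Hno, nth_In, Hj.
  - intros Hin; destruct (In_nth ls l [] Hin) as (k & Hk & <-).
    split; [apply (chain_C _ _ _ _ HC), Hk|].
    rewrite (chain_weight Q eta H V) by assumption.
    pose proof (chain_incr _ _ _ _ HC k Hk); lra.
Qed.

(** A trace at this level extends to a crossing at this level, and there is only one. *)
Lemma chain_subtrace_iff (Q : rect) (H : Z -> Z -> R) (V : nat -> R) (ls : list trace)
  (l : trace) (k : nat) :
  even_rect Q -> is_height Q H -> level_chain Q H V ls -> sub_Sbar Q l -> (k < length ls)%nat ->
  (subtrace l (nth k ls []) <-> at_level H l (V (S k))).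
Proof.
  intros HQ HH HC Hl Hk; pose proof (chain_C _ _ _ _ HC k Hk) as Ck.
  pose proof (chain_level _ _ _ _ HC k Hk) as Lk.
  rewrite subtrace_incl by (apply Hl || apply Ck); split.
  - intros Hincl; apply (incl_at_level H _ l (nth k ls [])); auto; [apply Hl|apply Ck].
  - intros Hlev; destruct (extend_to_C Q H _ l HH Hl Hlev) as (l' & C' & L' & Hincl).
    rewrite (level_unique Q H (V (S k)) (nth k ls []) l'); auto.
Qed.

(** The levels of [l] form an interval [(V a, V b]], so exactly the chain traces with index
    [a <= k < b] contain [l], and their weights telescope to its length. *)
Lemma chain_weight_formula (Q : rect) (eta : edge -> R) (H : Z -> Z -> R) (V : nat -> R)
  (ls : list trace) (l : trace) :
  even_rect Q -> is_potential Q eta H -> level_chain Q H V ls -> sub_Sbar Q l ->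
  weight eta l = wsum ls (map (weight eta) ls) (fun l' => indic (subtrace l l')).
Proof.
  intros HQ HP HC Hl.
  set (n := length ls).
  pose proof (chain_incr _ _ _ _ HC) as HV; fold n in HV.
  rewrite wsum_psum by apply length_map; fold n.
  pose proof (proj1 Hl) as T; pose proof (tlen_pos l T) as Hp.
  destruct (inter_intervals (fun r => exists m, (m <= n)%nat /\ r = V m)
    (fun k => early H (tedge l k)) (fun k => late H (tedge l k)) (tlen l - 1))
    as (lo & hi & (a & Ha & ->) & (b & Hb & ->) & Hlev).
  { intros k Hk; apply (chain_tedge_values Q H V ls); [exact HC|exact T|lia]. }
  assert (Hlev' : forall h, at_level H l h <-> V a < h <= V b).
  { intros h; rewrite <- Hlev; split; intros X k Hk; apply X; lia. }
  assert (Hterm : forall k, (k < n)%nat ->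
    nth k (map (weight eta) ls) 0 * indic (subtrace l (nth k ls [])) =
    (V (S k) - V k) * indic (a <= k < b)%nat).
  { intros k Hk.
    rewrite (nth_indep _ 0 (weight eta [])) by (rewrite length_map; exact Hk).
    rewrite map_nth, (chain_weight Q eta H V) by assumption; f_equal; apply indic_iff.
    rewrite (chain_subtrace_iff Q H V ls l k HQ (proj1 HP) HC Hl Hk), Hlev'.
    rewrite (strict_chain_lt_iff V n), (strict_chain_le_iff V n) by (assumption || lia); lia. }
  rewrite (psum_ext _ _ n Hterm).
  destruct (Nat.le_gt_cases a b) as [Hab|Hba].
  - rewrite psum_telescope by assumption.
    apply (weight_level_interval Q eta H); auto.
    apply (strict_chain_le_iff V n); auto.
  (* No level passes through [l] here; the vanishing sum is written with an empty index range so
     that the telescoping lemma applies again. *)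
  - rewrite (psum_ext _ (fun k => (V (S k) - V k) * indic (0 <= k < 0)%nat)).
    + rewrite psum_telescope by lia.
      rewrite (weight_no_level Q eta H); auto; [ring|].
      intros h Hh; apply Hlev' in Hh.
      pose proof (strict_chain_lt V n b a HV Hba Ha); lra.
    + intros k _; f_equal; apply indic_iff; lia.
Qed.

(** * Edges and corners as short traces *)

Lemma wsum_ext (ls : list trace) (ws : list R) (f g : trace -> R) :
  (forall l, In l ls -> f l = g l) -> wsum ls ws f = wsum ls ws g.
Proof.
  revert ws; induction ls as [|l ls IH]; intros [|w ws] E; try reflexivity.
  change (w * f l + wsum ls ws f = w * g l + wsum ls ws g).
  rewrite (E l), (IH ws); auto with datatypes.
Qed.

Definition edge_trace (e : edge) : trace :=
  if snd e then [e_lo e; e_hi e] else [e_hi e; e_lo e].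

Lemma inE_ends (Q : rect) (e : edge) : inE Q e -> inSbar Q (e_lo e) /\ inSbar Q (e_hi e).
Proof.
  pose proof (edge_ends e) as He.
  intros [Hs|Hs]; split; try (left; exact Hs);
    eapply inSbar_step; try exact Hs; destruct (snd e); tauto.
Qed.

Lemma edge_trace_sub (Q : rect) (e : edge) : inE Q e -> sub_Sbar Q (edge_trace e).
Proof.
  intros He; pose proof (inE_ends Q e He) as [Hlo Hhi]; pose proof (edge_ends e) as Hs.
  unfold edge_trace; destruct (snd e).
  - apply sub_Sbar_intro; simpl; auto; [|intros [|i] Hi; simpl in Hi; unfold tlen in Hi; simpl in Hi; lia].
    apply is_trace_steps; [simpl; lia|exact (inSbar_even Q _ Hlo)|].
    intros [|k] Hk; [left; exact Hs|unfold tlen in Hk; simpl in Hk; lia].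
  - apply sub_Sbar_intro; simpl; auto;
      [|intros [|i] Hi; simpl in Hi; unfold tlen in Hi; simpl in Hi; lia
       |unfold inE in He; tauto].
    apply is_trace_steps; [simpl; lia|exact (inSbar_even Q _ Hhi)|].
    intros [|k] Hk; [right; exact Hs|unfold tlen in Hk; simpl in Hk; lia].
Qed.

Lemma edge_trace_level (H : Z -> Z -> R) (e : edge) (h : R) :
  at_level H (edge_trace e) h <-> early H e < h <= late H e.
Proof.
  assert (E : tedge (edge_trace e) 0 = e).
  { pose proof (mkedge_ends e) as M; unfold edge_trace, tedge; destruct (snd e); exact M. }
  assert (T : tlen (edge_trace e) = 1%nat) by (unfold edge_trace; destruct (snd e); reflexivity).
  unfold at_level; rewrite T; split.
  - intros X; specialize (X 0%nat ltac:(lia)); rewrite E in X; exact X.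
  - intros X k Hk; replace k with 0%nat by lia; rewrite E; exact X.
Qed.

(** The weight formula for the trace made of [e] alone, whose weight is [eta e]. *)
Lemma flow_decomposition (Q : rect) (eta : edge -> R) (H : Z -> Z -> R) (V : nat -> R)
  (ls : list trace) (e : edge) :
  even_rect Q -> is_potential Q eta H -> level_chain Q H V ls -> inE Q e ->
  (0 <= eta e) ->
  eta e = wsum ls (map (weight eta) ls) (fun l => indic (is_edge_of e l)).
Proof.
  intros HQ HP HC He Hpos.
  pose proof (edge_trace_sub Q e He) as Hs.
  assert (Ew : eta e = late H e - early H e) by (apply HP, He).
  rewrite Ew, <- (weight_level_interval Q eta H (edge_trace e) (early H e) (late H e)); auto;
    [|lra|apply edge_trace_level].
  rewrite (chain_weight_formula Q eta H V ls) by assumption.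
  apply wsum_ext; intros l Hl; apply (chain_posC Q eta H V ls) in Hl; auto.
  destruct Hl as [Cl _]; apply indic_iff.
  rewrite subtrace_incl, is_edge_of_In by (apply Cl || apply Hs).
  unfold edge_trace, incl; destruct (snd e); simpl; intuition (subst; auto).
Qed.

Definition corner_trace (y : pt) : trace :=
  [((tc y + 1)%Z, (xc y - 1)%Z); y; ((tc y + 1)%Z, (xc y + 1)%Z)].

Lemma corner_steps (y : pt) :
  step_down ((tc y + 1)%Z, (xc y - 1)%Z) y /\ step_up y ((tc y + 1)%Z, (xc y + 1)%Z).
Proof. unfold step_down, step_up, uc, vc; simpl; lia. Qed.

Lemma corner_trace_sub (Q : rect) (y : pt) : inS Q y -> sub_Sbar Q (corner_trace y).
Proof.
  intros Hy; destruct (corner_steps y) as [S1 S2].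
  assert (B1 : inSbar Q ((tc y + 1)%Z, (xc y - 1)%Z)) by (apply (inSbar_step Q y); tauto).
  assert (B2 : inSbar Q ((tc y + 1)%Z, (xc y + 1)%Z)) by (apply (inSbar_step Q y); tauto).
  apply sub_Sbar_intro; simpl; auto.
  - apply is_trace_steps; [simpl; lia|exact (inSbar_even Q _ B1)|].
    intros [|[|k]] Hk; [right; exact S1|left; exact S2|unfold tlen in Hk; simpl in Hk; lia].
  - intros [|[|i]] Hi; unfold tlen in Hi; simpl in Hi; try lia; exact Hy.
Qed.

(** Both edges of a left corner have the same later face, so the length of their common levels is
    the smaller of the two flows, which is the birth field. *)
Lemma corner_trace_level (H : Z -> Z -> R) (y : pt) (h : R) :
  at_level H (corner_trace y) h <->
  Rmax (early H (eSE y)) (early H (eNE y)) < h <= late H (eNE y).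
Proof.
  destruct (corner_steps y) as [S1 S2].
  destruct (star_early_late H y) as (_ & _ & A3 & A4 & _ & _ & A7 & A8).
  assert (E0 : tedge (corner_trace y) 0 = eSE y) by (apply mkedge_down, S1).
  assert (E1 : tedge (corner_trace y) 1 = eNE y) by (apply mkedge_up, S2).
  unfold at_level; change (tlen (corner_trace y)) with 2%nat; split.
  - intros X; pose proof (X 0%nat ltac:(lia)) as X0; pose proof (X 1%nat ltac:(lia)) as X1.
    rewrite E0 in X0; rewrite E1 in X1; unfold edge_level in *.
    split; [apply Rmax_lub_lt|]; lra.
  - intros X [|[|k]] Hk; [rewrite E0|rewrite E1|lia]; unfold edge_level;
      pose proof (Rmax_l (early H (eSE y)) (early H (eNE y)));
      pose proof (Rmax_r (early H (eSE y)) (early H (eNE y))); lra.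
Qed.

Lemma birth_decomposition (Q : rect) (eta : edge -> R) (H : Z -> Z -> R) (V : nat -> R)
  (ls : list trace) (y : pt) :
  even_rect Q -> is_potential Q eta H -> level_chain Q H V ls -> inS Q y ->
  0 <= birth eta y ->
  birth eta y = wsum ls (map (weight eta) ls) (fun l => indic (is_left_corner l y)).
Proof.
  intros HQ HP HC Hy Hpos.
  pose proof (corner_trace_sub Q y Hy) as Hs.
  destruct (star_height Q eta H y HP Hy) as (_ & ESE & _ & ENE).
  destruct (star_early_late H y) as (_ & _ & A3 & A4 & _ & _ & A7 & A8).
  assert (Eb : birth eta y = late H (eNE y) - Rmax (early H (eSE y)) (early H (eNE y)))
    by (unfold birth, Rmin, Rmax; repeat destruct Rle_dec; lra).
  rewrite Eb, <- (weight_level_interval Q eta H (corner_trace y)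
    (Rmax (early H (eSE y)) (early H (eNE y))) (late H (eNE y))); auto;
    [|lra|apply corner_trace_level].
  rewrite (chain_weight_formula Q eta H V ls) by assumption.
  apply wsum_ext; intros l Hl; apply (chain_posC Q eta H V ls) in Hl; auto.
  destruct Hl as [Cl _]; apply indic_iff.
  rewrite subtrace_incl by (apply Cl || apply Hs).
  unfold corner_trace, is_left_corner, incl; simpl; intuition (subst; auto).
Qed.

Lemma zeta_plus_edge (Q : rect) (l : trace) (y : pt) : is_trace l -> inS Q y ->
  inBd Q ((tc y - 1)%Z, (xc y - 1)%Z) -> (is_edge_of (eSW y) l <-> zplus_tr Q l y).
Proof.
  intros Hl Hy Hb; rewrite is_edge_of_In by exact Hl.
  replace (e_hi (eSW y)) with y by (apply pt_eq; unfold e_hi, eSW, uc, vc, tc, xc; simpl; lia).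
  unfold zplus_tr, eSW, e_lo; simpl; tauto.
Qed.

Lemma zeta_minus_edge (Q : rect) (l : trace) (y : pt) : is_trace l -> inS Q y ->
  inBd Q ((tc y - 1)%Z, (xc y + 1)%Z) -> (is_edge_of (eNW y) l <-> zminus_tr Q l y).
Proof.
  intros Hl Hy Hb; rewrite is_edge_of_In by exact Hl.
  replace (e_hi (eNW y)) with y by (apply pt_eq; unfold e_hi, eNW, uc, vc, tc, xc; simpl; lia).
  unfold zminus_tr, eNW, e_lo; simpl; tauto.
Qed.

(** * Order of crossing traces *)

Lemma clamp_mono (lo hi z z' : Z) : (z <= z')%Z -> (clamp lo hi z <= clamp lo hi z')%Z.
Proof. unfold clamp; lia. Qed.

Lemma clamp_range (lo hi z : Z) : (lo <= hi)%Z -> (lo <= clamp lo hi z <= hi)%Z.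
Proof. unfold clamp; lia. Qed.

Lemma clamp_id (lo hi z : Z) : (lo <= z <= hi)%Z -> clamp lo hi z = z.
Proof. unfold clamp; lia. Qed.

Lemma clamp_idem (lo hi z : Z) : clamp lo hi (clamp lo hi z) = clamp lo hi z.
Proof. unfold clamp; lia. Qed.

(** [later_side] on the faces touching the domain, copied outwards by clamping so that its indicator
    is a height function. *)
Definition later (Q : rect) (l : trace) (u v : Z) : Prop :=
  later_side l (clamp (ra Q - 2) (rb Q) u) (clamp (rc Q - 2) (rd Q) v).

Lemma later_mono (Q : rect) (l : trace) (u u' v v' : Z) :
  (u <= u')%Z -> (v <= v')%Z -> later Q l u v -> later Q l u' v'.
Proof.
  intros Hu Hv [y (Hy & H1 & H2)]; exists y; split; [exact Hy|].
  pose proof (clamp_mono (ra Q - 2) (rb Q) u u' Hu).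
  pose proof (clamp_mono (rc Q - 2) (rd Q) v v' Hv); lia.
Qed.

(** The two faces beside an edge of the closure have indices within the clamping range, so
    [later_side_edge] carries over. *)
Lemma later_edge (Q : rect) (l : trace) (k : nat) : sub_Sbar Q l -> (k < tlen l)%nat ->
  let e := tedge l k in
  later Q l (uc (e_lo e)) (vc (e_lo e)) /\
  ~ (if snd e then later Q l (uc (e_lo e)) (vc (e_lo e) - 2)
     else later Q l (uc (e_lo e) - 2) (vc (e_lo e))).
Proof.
  intros (Hl & _ & _ & _ & HE) Hk e; specialize (HE k Hk); fold e in HE.
  pose proof (later_side_edge l k Hl Hk) as L; fold e in L; cbv zeta in L.
  pose proof (edge_ends e) as Hs; unfold inE in HE; rewrite !inS_uv in HE.
  unfold later; destruct (snd e); destruct Hs as [E1 E2]; rewrite E1, E2 in HE || idtac;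
    rewrite !clamp_id by lia; exact L.
Qed.

Lemma later_incl (Q : rect) (l l' : trace) (u v : Z) :
  even_rect Q -> inC Q l -> inC Q l' -> succeq l' l -> later Q l' u v -> later Q l u v.
Proof.
  intros HQ C C' Hs; pose proof HQ as (_ & _ & _ & _ & Hab & Hcd).
  apply (later_side_incl Q); auto; apply clamp_range; lia.
Qed.

Lemma indic_le (P P' : Prop) : (P -> P') -> indic P <= indic P'.
Proof. intros HP; unfold indic; repeat destruct excluded_middle_informative; tauto || lra. Qed.

Lemma later_height (Q : rect) (l : trace) : is_height Q (fun u v => indic (later Q l u v)).
Proof.
  split.
  - intros u u' v v' Hu Hv; apply indic_le, later_mono; assumption.
  - intros u v; unfold later; rewrite !clamp_idem; reflexivity.
Qed.

Lemma later_at_level (Q : rect) (l l' : trace) : sub_Sbar Q l ->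
  (forall u v, later Q l u v <-> later Q l' u v) ->
  at_level (fun u v => indic (later Q l' u v)) l 1.
Proof.
  intros Hl E k Hk; destruct (later_edge Q l k Hl Hk) as [L1 L2].
  unfold edge_level, early, late; rewrite (indic_true _ (proj1 (E _ _) L1)).
  split; [|lra]; destruct (snd (tedge l k)); rewrite indic_false; try lra; rewrite <- E; exact L2.
Qed.

(** The later sides are included in each other, hence equal, so both traces lie at level 1 of the
    same indicator height, where [level_unique] applies. *)
Lemma succeq_antisym (Q : rect) (l l' : trace) :
  even_rect Q -> inC Q l -> inC Q l' -> succeq l l' -> succeq l' l -> l = l'.
Proof.
  intros HQ C C' H1 H2.
  apply (level_unique Q (fun u v => indic (later Q l' u v)) 1); auto using later_height.
  - apply later_at_level; [apply C|].
    intros u v; split; apply later_incl; assumption.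
  - apply later_at_level; [apply C'|tauto].
Qed.

(** With [l1] and [l3] comparable, only a cycle could violate transitivity. A cycle makes the three
    later sides equal, and then [l1 = l3]. *)
Lemma succeq_trans_total (Q : rect) (l1 l2 l3 : trace) :
  even_rect Q -> inC Q l1 -> inC Q l2 -> inC Q l3 ->
  succeq l1 l3 \/ succeq l3 l1 -> succeq l1 l2 -> succeq l2 l3 -> succeq l1 l3.
Proof.
  intros HQ C1 C2 C3 [H13|H31] H12 H23; [exact H13|].
  assert (E : l1 = l3).
  { apply (level_unique Q (fun u v => indic (later Q l3 u v)) 1); auto using later_height.
    - apply later_at_level; [apply C1|].
      intros u v; split; [|apply later_incl; assumption].
      intros L; apply (later_incl Q l3 l2); auto; apply (later_incl Q l2 l1); auto.
    - apply later_at_level; [apply C3|tauto]. }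
  subst; exact H31.
Qed.

(** * The flow field of a chain *)

(** When the sets holding a face are nested, they form an initial segment of the chain, so the
    height of the face is a partial sum of the weights. *)
Lemma nested_sum (w : nat -> R) (B : nat -> Prop) (n : nat) :
  (forall i j, (i < j < n)%nat -> B j -> B i) ->
  exists m, (m <= n)%nat /\ (forall k, (k < n)%nat -> (B k <-> (k < m)%nat)) /\
    psum (fun k => w k * indic (B k)) n = psum w m.
Proof.
  induction n as [|n IH]; intros HB; [exists 0%nat; repeat split; auto; lia|].
  destruct IH as (m & Hm & E & Es); [intros; apply (HB i j); auto; lia|].
  destruct (excluded_middle_informative (B n)) as [Hn|Hn].
  - assert (m = n) as ->.
    { destruct (Nat.eq_dec m n) as [|Hne]; [assumption|].
      pose proof (proj1 (E m ltac:(lia)) (HB m n ltac:(lia) Hn)); lia. }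
    exists (S n); split; [lia|split].
    + intros k Hk; split; [auto|intros _].
      destruct (Nat.eq_dec k n) as [->|]; [exact Hn|apply E; lia].
    + simpl; rewrite Es, indic_true by exact Hn; ring.
  - exists m; split; [lia|split].
    + intros k Hk; destruct (Nat.eq_dec k n) as [->|]; [split; [tauto|lia]|apply E; lia].
    + simpl; rewrite Es, indic_false by exact Hn; ring.
Qed.

Definition chain_height (Q : rect) (ls : list trace) (ws : list R) (u v : Z) : R :=
  psum (fun j => nth j ws 0 * indic (later Q (nth j ls []) u v)) (length ls).

Lemma chain_height_is_height (Q : rect) (ls : list trace) (ws : list R) :
  valid_data Q ls ws -> is_height Q (chain_height Q ls ws).
Proof.
  intros (Hlen & _ & _ & Hw); split.
  - intros u u' v v' Hu Hv; apply psum_le; intros k Hk.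
    apply Rmult_le_compat_l; [apply Rlt_le, Hw; lia|].
    apply indic_le, later_mono; assumption.
  - intros u v; unfold chain_height, later; apply psum_ext; intros k _.
    rewrite !clamp_idem; reflexivity.
Qed.

(** A face on the later side of exactly the first [m] traces has height [V m]. An edge of the [k]-th
    trace therefore has [m <= k] on its earlier side and [m > k] on its later side. *)
Lemma chain_height_chain (Q : rect) (ls : list trace) (ws : list R) :
  even_rect Q -> valid_data Q ls ws ->
  level_chain Q (chain_height Q ls ws) (psum (fun j => nth j ws 0)) ls.
Proof.
  intros HQ Hval; pose proof Hval as (Hlen & HC & Hprec & Hw).
  set (V := psum (fun j => nth j ws 0)).
  assert (HV : forall k, (k < length ls)%nat -> V k < V (S k)).
  { intros k Hk; unfold V; simpl; pose proof (Hw k ltac:(lia)); lra. }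
  assert (Hval' : forall u v, exists m, (m <= length ls)%nat /\
    (forall k, (k < length ls)%nat -> (later Q (nth k ls []) u v <-> (k < m)%nat)) /\
    chain_height Q ls ws u v = V m).
  { intros u v; apply nested_sum; intros i j Hij.
    apply later_incl; auto; [apply HC; lia|apply HC; lia|apply (Hprec i j Hij)]. }
  constructor; auto.
  - intros k Hk j Hj; pose proof (HC k Hk) as Ck.
    destruct (later_edge Q (nth k ls []) j (proj1 Ck) Hj) as [L1 L2].
    unfold edge_level, early, late; split.
    + assert (Hlo : forall u v, ~ later Q (nth k ls []) u v -> chain_height Q ls ws u v < V (S k)).
      { intros u v Hn; destruct (Hval' u v) as (m & Hm & E & ->).
        rewrite E in Hn by exact Hk.
        apply (strict_chain_lt V (length ls)); auto; lia. }
      destruct (snd (tedge (nth k ls []) j)); apply Hlo, L2.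
    + destruct (Hval' (uc (e_lo (tedge (nth k ls []) j))) (vc (e_lo (tedge (nth k ls []) j))))
        as (m & Hm & E & ->).
      apply E in L1; [|exact Hk].
      apply (strict_chain_le_iff V (length ls)); auto; lia.
  - intros i j Hij E; apply (proj2 (Hprec i j Hij)); congruence.
  - intros u v _ _; destruct (Hval' u v) as (m & Hm & _ & E); exists m; auto.
Qed.

Definition height_flow (H : Z -> Z -> R) (e : edge) : R := late H e - early H e.

(** Both sides of the conservation law equal the height difference between the latest and the
    earliest face around [y]. *)
Lemma height_flow_is_flow (Q : rect) (H : Z -> Z -> R) : is_height Q H -> is_flow Q (height_flow H).
Proof.
  intros [Hm _]; split.
  - intros e _; unfold height_flow, late, early.
    enough ((if snd e then H (uc (e_lo e)) (vc (e_lo e) - 2)%Z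
             else H (uc (e_lo e) - 2)%Z (vc (e_lo e))) <= H (uc (e_lo e)) (vc (e_lo e))) by lra.
    destruct (snd e); apply Hm; lia.
  - intros y _; unfold height_flow.
    destruct (star_early_late H y) as (A1 & A2 & A3 & A4 & A5 & A6 & A7 & A8); lra.
Qed.

(** * The height function of a flow field *)

(** Sum of the flow across a path of faces from the earliest one: [m] steps in [u] along the row
    [v = rc - 2], then [n] steps in [v]. *)
Definition flow_grid (Q : rect) (eta : edge -> R) (m n : nat) : R :=
  psum (fun i => eta (pt_uv (ra Q + 2 * Z.of_nat i) (rc Q - 2), false)) m +
  psum (fun j => eta (pt_uv (ra Q - 2 + 2 * Z.of_nat m) (rc Q + 2 * Z.of_nat j), true)) n.

Lemma even_add (a b : Z) : Z.Even a -> Z.Even b -> Z.Even (a + b).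
Proof. intros [m ->] [n ->]; exists (m + n)%Z; lia. Qed.

Lemma even_double (a : Z) : Z.Even (2 * a).
Proof. exists a; reflexivity. Qed.

Lemma grid_edge_down (Q : rect) (u v : Z) : Z.Even u -> Z.Even v ->
  (ra Q <= u <= rb Q)%Z -> (rc Q - 2 <= v <= rd Q)%Z -> even_rect Q ->
  inE Q (pt_uv u v, false).
Proof.
  intros Eu Ev Hu Hv ((a & Ea) & _ & (c & Ec) & _ & _ & Hcd).
  pose proof (edge_ends (pt_uv u v, false)) as [E1 E2]; unfold e_lo in E1, E2; simpl in E1, E2.
  rewrite uc_pt_uv in E1 by assumption; rewrite vc_pt_uv in E2 by assumption.
  unfold inE; rewrite !inS_uv, <- E1; unfold e_lo; simpl fst.
  rewrite uc_pt_uv, vc_pt_uv by assumption.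
  destruct Ev as [m Em]; destruct (Z_lt_le_dec v (rc Q)); [right|left]; (split; [exact Eu|lia]).
Qed.

Lemma grid_edge_up (Q : rect) (u v : Z) : Z.Even u -> Z.Even v ->
  (ra Q - 2 <= u <= rb Q)%Z -> (rc Q <= v <= rd Q)%Z -> even_rect Q ->
  inE Q (pt_uv u v, true).
Proof.
  intros Eu Ev Hu Hv ((a & Ea) & _ & (c & Ec) & _ & Hab & _).
  pose proof (edge_ends (pt_uv u v, true)) as [E1 E2]; unfold e_lo in E1, E2; simpl in E1, E2.
  rewrite uc_pt_uv in E1 by assumption; rewrite vc_pt_uv in E2 by assumption.
  unfold inE; rewrite !inS_uv, E1, E2; unfold e_lo; simpl fst.
  rewrite uc_pt_uv, vc_pt_uv by assumption.
  pose proof (even_add2 u Eu) as Eu2; destruct Eu as [m Em].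
  destruct (Z_lt_le_dec u (ra Q)); [right|left]; (split; [exact Eu2 || (exists m; exact Em)|lia]).
Qed.

(** Path independence: passing from row [n] to the next, the conservation law at the lattice point
    between the four faces turns the claim for one row into the claim for the next. *)
Lemma flow_grid_row (Q : rect) (eta : edge -> R) (m n : nat) :
  even_rect Q -> is_flow Q eta ->
  (ra Q + 2 * Z.of_nat m <= rb Q)%Z -> (rc Q - 2 + 2 * Z.of_nat n <= rd Q)%Z ->
  flow_grid Q eta (S m) n - flow_grid Q eta m n =
  eta (pt_uv (ra Q + 2 * Z.of_nat m) (rc Q - 2 + 2 * Z.of_nat n), false).
Proof.
  intros HQ [_ Hcons] Hm; pose proof HQ as (Ea & Eb & Ec & Ed & Hab & Hcd).
  induction n as [|n IH]; intros Hn.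
  - unfold flow_grid; cbn [psum].
    replace (rc Q - 2 + 2 * Z.of_nat 0)%Z with (rc Q - 2)%Z by lia; ring.
  - specialize (IH ltac:(lia)).
    set (u := (ra Q + 2 * Z.of_nat m)%Z) in *; set (v := (rc Q + 2 * Z.of_nat n)%Z).
    assert (Eu : Z.Even u) by (apply even_add; auto using even_double).
    assert (Ev : Z.Even v) by (apply even_add; auto using even_double).
    replace (rc Q - 2 + 2 * Z.of_nat n)%Z with (v - 2)%Z in IH by lia.
    replace (rc Q - 2 + 2 * Z.of_nat (S n))%Z with v by lia.
    assert (Hy : inS Q (pt_uv u v)).
    { apply inS_uv; rewrite uc_pt_uv, vc_pt_uv by assumption; split; [exact Eu|lia]. }
    specialize (Hcons _ Hy).
    assert (ENW : eNW (pt_uv u v) = (pt_uv u (v - 2), false)).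
    { apply (f_equal (fun y : pt => (y, false))), pt_eq.
      - rewrite uc_pt_uv by (auto using even_sub2).
        pose proof (uc_pt_uv u v Eu Ev) as E; unfold uc in *; simpl in *; lia.
      - rewrite vc_pt_uv by (auto using even_sub2).
        pose proof (vc_pt_uv u v Eu Ev) as E; unfold vc in *; simpl in *; lia. }
    assert (ESW : eSW (pt_uv u v) = (pt_uv (u - 2) v, true)).
    { apply (f_equal (fun y : pt => (y, true))), pt_eq.
      - rewrite uc_pt_uv by (auto using even_sub2).
        pose proof (uc_pt_uv u v Eu Ev) as E; unfold uc in *; simpl in *; lia.
      - rewrite vc_pt_uv by (auto using even_sub2).
        pose proof (vc_pt_uv u v Eu Ev) as E; unfold vc in *; simpl in *; lia. }
    rewrite ENW, ESW in Hcons; unfold eNE, eSE in Hcons.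
    unfold flow_grid in *; cbn [psum] in *.
    replace (ra Q - 2 + 2 * Z.of_nat (S m))%Z with u in * by lia.
    replace (ra Q - 2 + 2 * Z.of_nat m)%Z with (u - 2)%Z in * by lia.
    fold v; lra.
Qed.

Lemma flow_grid_mono (Q : rect) (eta : edge -> R) (m m' n n' : nat) :
  even_rect Q -> is_flow Q eta -> (m <= m')%nat -> (n <= n')%nat ->
  (ra Q - 2 + 2 * Z.of_nat m' <= rb Q)%Z -> (rc Q - 2 + 2 * Z.of_nat n' <= rd Q)%Z ->
  flow_grid Q eta m n <= flow_grid Q eta m' n'.
Proof.
  intros HQ Hf Hm Hn Hm' Hn'; pose proof HQ as (Ea & Eb & Ec & Ed & Hab & Hcd).
  apply Rle_trans with (flow_grid Q eta m' n).
  - assert (Hn2 : (rc Q - 2 + 2 * Z.of_nat n <= rd Q)%Z) by lia.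
    clear Hn; induction Hm as [|m' Hm IH]; [lra|].
    specialize (IH ltac:(lia)).
    assert (0 <= flow_grid Q eta (S m') n - flow_grid Q eta m' n); [|lra].
    rewrite flow_grid_row by (assumption || lia).
    apply Hf, grid_edge_down; auto; try lia; apply even_add; auto using even_double, even_sub2.
  - induction Hn as [|n' Hn IH]; [lra|].
    specialize (IH ltac:(lia)).
    apply Rle_trans with (1 := IH).
    unfold flow_grid; cbn [psum].
    assert (0 <= eta (pt_uv (ra Q - 2 + 2 * Z.of_nat m') (rc Q + 2 * Z.of_nat n'), true)); [|lra].
    apply Hf, grid_edge_up; auto; try lia; apply even_add; auto using even_double, even_sub2.
Qed.

(** Rounds down, so that the height is defined and monotone at odd indices as well, as [is_height]
    requires. *)
Definition half_index (lo z : Z) : nat := Z.to_nat ((z - lo) / 2).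

Lemma half_index_le (lo z : Z) : (lo <= z)%Z -> (lo + 2 * Z.of_nat (half_index lo z) <= z)%Z.
Proof.
  intros Hz; unfold half_index.
  pose proof (Z.div_pos (z - lo) 2); pose proof (Z.mul_div_le (z - lo) 2); lia.
Qed.

Lemma half_index_mono (lo z z' : Z) : (z <= z')%Z -> (half_index lo z <= half_index lo z')%nat.
Proof.
  intros Hz; unfold half_index.
  pose proof (Z.div_le_mono (z - lo) (z' - lo) 2); lia.
Qed.

Lemma half_index_even (lo : Z) (m : nat) : half_index lo (lo + 2 * Z.of_nat m) = m.
Proof.
  unfold half_index.
  replace (lo + 2 * Z.of_nat m - lo)%Z with (Z.of_nat m * 2)%Z by lia.
  rewrite Z.div_mul by lia; lia.
Qed.

Lemma even_offset (lo z : Z) : Z.Even lo -> Z.Even z -> (lo <= z)%Z ->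
  exists m : nat, z = (lo + 2 * Z.of_nat m)%Z.
Proof. intros [a ->] [b ->] Hle; exists (Z.to_nat (b - a)); lia. Qed.

Definition flow_height (Q : rect) (eta : edge -> R) (u v : Z) : R :=
  flow_grid Q eta (half_index (ra Q - 2) (clamp (ra Q - 2) (rb Q) u))
                  (half_index (rc Q - 2) (clamp (rc Q - 2) (rd Q) v)).

Lemma flow_height_even (Q : rect) (eta : edge -> R) (m n : nat) :
  (ra Q - 2 + 2 * Z.of_nat m <= rb Q)%Z -> (rc Q - 2 + 2 * Z.of_nat n <= rd Q)%Z ->
  flow_height Q eta (ra Q - 2 + 2 * Z.of_nat m) (rc Q - 2 + 2 * Z.of_nat n) = flow_grid Q eta m n.
Proof.
  intros Hm Hn; unfold flow_height.
  rewrite !clamp_id by lia; rewrite !half_index_even; reflexivity.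
Qed.

(** Across an edge with flag [true] the height grows by the last step of the defining path; for flag
    [false] this is [flow_grid_row]. *)
Lemma flow_potential (Q : rect) (eta : edge -> R) :
  even_rect Q -> is_flow Q eta -> is_potential Q eta (flow_height Q eta).
Proof.
  intros HQ Hf; pose proof HQ as (Ea & Eb & Ec & Ed & Hab & Hcd); split; [split|].
  - intros u u' v v' Hu Hv.
    pose proof (clamp_range (ra Q - 2) (rb Q) u' ltac:(lia)).
    pose proof (clamp_range (rc Q - 2) (rd Q) v' ltac:(lia)).
    apply flow_grid_mono; auto using half_index_mono, clamp_mono.
    + pose proof (half_index_le (ra Q - 2) (clamp (ra Q - 2) (rb Q) u')); lia.
    + pose proof (half_index_le (rc Q - 2) (clamp (rc Q - 2) (rd Q) v')); lia.
  - intros u v; unfold flow_height; rewrite !clamp_idem; reflexivity.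
  - intros e He.
    pose proof (inSbar_even Q _ (proj1 (inE_ends Q e He))) as Eu.
    assert (Ev : Z.Even (vc (e_lo e)))
      by (destruct Eu as [k Hk]; exists (k - xc (e_lo e))%Z; unfold uc, vc in *; lia).
    assert (Ee : e = (pt_uv (uc (e_lo e)) (vc (e_lo e)), snd e)).
    { destruct e as [y d]; unfold e_lo in *; simpl in *; f_equal.
      apply pt_eq; [rewrite uc_pt_uv|rewrite vc_pt_uv]; auto. }
    unfold inE in He; rewrite !inS_uv in He.
    pose proof (edge_ends e) as Hs; unfold late, early.
    rewrite Ee at 1; destruct (snd e); destruct Hs as [E1 E2]; rewrite E1, E2 in He || idtac.
    + destruct (even_offset (ra Q - 2) (uc (e_lo e))) as [m Em];
        [apply even_sub2; auto|auto|lia|].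
      destruct (even_offset (rc Q) (vc (e_lo e))) as [n En]; [auto|auto|lia|].
      rewrite Em, En.
      replace (rc Q + 2 * Z.of_nat n)%Z with (rc Q - 2 + 2 * Z.of_nat (S n))%Z by lia.
      replace (rc Q - 2 + 2 * Z.of_nat (S n) - 2)%Z with (rc Q - 2 + 2 * Z.of_nat n)%Z by lia.
      rewrite !flow_height_even by lia; unfold flow_grid; cbn [psum].
      replace (rc Q - 2 + 2 * Z.of_nat (S n))%Z with (rc Q + 2 * Z.of_nat n)%Z by lia; ring.
    + destruct (even_offset (ra Q) (uc (e_lo e))) as [m Em]; [auto|auto|lia|].
      destruct (even_offset (rc Q - 2) (vc (e_lo e))) as [n En];
        [apply even_sub2; auto|auto|lia|].
      rewrite Em, En, <- flow_grid_row by (assumption || lia).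
      replace (ra Q + 2 * Z.of_nat m - 2)%Z with (ra Q - 2 + 2 * Z.of_nat m)%Z by lia.
      replace (ra Q + 2 * Z.of_nat m)%Z with (ra Q - 2 + 2 * Z.of_nat (S m))%Z by lia.
      rewrite !flow_height_even by lia; reflexivity.
Qed.

(** * The level chain of a height function *)

Lemma strict_sort (L : list R) :
  exists vs, StronglySorted Rlt vs /\ forall r, In r vs <-> In r L.
Proof.
  induction L as [|x L (vs & Hs & E)]; [exists []; split; [constructor|tauto]|].
  enough (exists vs', StronglySorted Rlt vs' /\ forall r, In r vs' <-> r = x \/ In r vs)
    as (vs' & Hs' & E').
  { exists vs'; split; [exact Hs'|]; intros r; rewrite E', E; simpl; intuition auto. }
  clear L E; induction Hs as [|v vs Hs IH Hv].
  - exists [x]; split; [repeat constructor|simpl; intuition auto].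
  - rewrite Forall_forall in Hv.
    destruct (Rtotal_order x v) as [Hlt|[->|Hgt]].
    + exists (x :: v :: vs); split; [|simpl; intuition auto].
      constructor; [constructor; [exact Hs|now apply Forall_forall]|].
      apply Forall_forall; intros r [<-|Hr]; [exact Hlt|].
      specialize (Hv r Hr); lra.
    + exists (v :: vs); split; [|simpl; intuition auto].
      constructor; [exact Hs|now apply Forall_forall].
    + destruct IH as (vs' & Hs' & E').
      exists (v :: vs'); split; [|simpl; intros r; rewrite E'; intuition auto].
      constructor; [exact Hs'|]; apply Forall_forall; intros r Hr; apply E' in Hr.
      destruct Hr as [->|Hr]; [exact Hgt|auto].
Qed.

Lemma StronglySorted_nth_lt (vs : list R) (k : nat) :
  StronglySorted Rlt vs -> (S k < length vs)%nat -> nth k vs 0 < nth (S k) vs 0.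
Proof.
  intros Hs; revert k; induction Hs as [|v vs Hs IH Hv]; intros k Hk; [simpl in Hk; lia|].
  rewrite Forall_forall in Hv; destruct k as [|k].
  - simpl; apply Hv, nth_In; simpl in Hk; lia.
  - apply IH; simpl in Hk; lia.
Qed.

Lemma list_choice {A : Type} (d : A) (P : nat -> A -> Prop) (n : nat) :
  (forall k, (k < n)%nat -> exists a, P k a) ->
  exists l, length l = n /\ forall k, (k < n)%nat -> P k (nth k l d).
Proof.
  induction n as [|n IH]; intros HP; [exists []; split; [reflexivity|lia]|].
  destruct IH as (l & Hl & E); [auto|]; destruct (HP n ltac:(lia)) as [a Ha].
  exists (l ++ [a]); split; [rewrite length_app; simpl; lia|].
  intros k Hk; destruct (Nat.eq_dec k n) as [->|].
  - rewrite app_nth2, Hl, Nat.sub_diag by lia; exact Ha.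
  - rewrite app_nth1 by lia; apply E; lia.
Qed.

(* Walking down from a face of height [r] to the earliest face, the height first
   drops below [r] across an edge whose later face has height exactly [r]. *)
Lemma value_edge (Q : rect) (H : Z -> Z -> R) (s m n : nat) :
  even_rect Q -> is_height Q H -> (m + n <= s)%nat ->
  (ra Q - 2 + 2 * Z.of_nat m <= rb Q)%Z -> (rc Q - 2 + 2 * Z.of_nat n <= rd Q)%Z ->
  let r := H (ra Q - 2 + 2 * Z.of_nat m)%Z (rc Q - 2 + 2 * Z.of_nat n)%Z in
  H (ra Q - 2)%Z (rc Q - 2)%Z < r ->
  exists e, inE Q e /\ early H e < r /\ late H e = r.
Proof.
  intros HQ HH; pose proof HQ as (Ea & Eb & Ec & Ed & Hab & Hcd).
  revert m n; induction s as [|s IH]; intros m n Hs Hm Hn r Hr.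
  - assert (m = 0 /\ n = 0)%nat as [-> ->] by lia; unfold r in Hr.
    rewrite !Z.add_0_r in Hr; lra.
  - set (u := (ra Q - 2 + 2 * Z.of_nat m)%Z) in *; set (v := (rc Q - 2 + 2 * Z.of_nat n)%Z) in *.
    assert (Eu : Z.Even u) by (apply even_add; auto using even_double, even_sub2).
    assert (Ev : Z.Even v) by (apply even_add; auto using even_double, even_sub2).
    assert (Hle : forall u' v', (u' <= u)%Z -> (v' <= v)%Z -> H u' v' <= r)
      by (intros; apply HH; assumption).
    destruct m as [|m].
    + destruct n as [|n]; [unfold r, u, v in Hr; rewrite !Z.add_0_r in Hr; lra|].
      destruct (Rlt_dec (H u (v - 2)%Z) r) as [Hlt|Hge].
      * exists (pt_uv u v, true); split; [apply grid_edge_up; auto; lia|].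
        unfold early, late, e_lo; simpl fst; simpl snd; cbv iota.
        rewrite uc_pt_uv, vc_pt_uv by assumption; auto.
      * assert (E : H u (v - 2)%Z = r) by (apply Rle_antisym; [apply Hle; lia|lra]).
        replace (v - 2)%Z with (rc Q - 2 + 2 * Z.of_nat n)%Z in E by lia.
        unfold u in E; clear Hle; destruct (IH 0%nat n) as (e & He & X1 & X2); [lia..| |].
        { rewrite E; exact Hr. }
        rewrite E in X1, X2; exists e; auto.
    + destruct (Rlt_dec (H (u - 2)%Z v) r) as [Hlt|Hge].
      * exists (pt_uv u v, false); split; [apply grid_edge_down; auto; lia|].
        unfold early, late, e_lo; simpl fst; simpl snd; cbv iota.
        rewrite uc_pt_uv, vc_pt_uv by assumption; auto.
      * assert (E : H (u - 2)%Z v = r) by (apply Rle_antisym; [apply Hle; lia|lra]).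
        replace (u - 2)%Z with (ra Q - 2 + 2 * Z.of_nat m)%Z in E by lia.
        unfold v in E; clear Hle; destruct (IH m n) as (e & He & X1 & X2); [lia..| |].
        { rewrite E; exact Hr. }
        rewrite E in X1, X2; exists e; auto.
Qed.

(** Clamping leaves finitely many heights. Each one above the least is attained just after an edge,
    and that edge, as a one-edge trace at this level, extends to a crossing. *)
Lemma height_chain (Q : rect) (H : Z -> Z -> R) :
  even_rect Q -> is_height Q H -> exists V ls, level_chain Q H V ls.
Proof.
  intros HQ HH; pose proof HQ as (Ea & Eb & Ec & Ed & Hab & Hcd).
  set (M := Z.to_nat ((rb Q - (ra Q - 2)) / 2)); set (N := Z.to_nat ((rd Q - (rc Q - 2)) / 2)).
  set (val := fun p : nat * nat =>
    H (ra Q - 2 + 2 * Z.of_nat (fst p))%Z (rc Q - 2 + 2 * Z.of_nat (snd p))%Z).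
  set (L := map val (list_prod (seq 0 (S M)) (seq 0 (S N)))).
  assert (HM : (ra Q - 2 + 2 * Z.of_nat M = rb Q)%Z).
  { unfold M; destruct Ea as [a Ea], Eb as [b Eb].
    replace (rb Q - (ra Q - 2))%Z with ((b - a + 1) * 2)%Z by lia.
    rewrite Z.div_mul by lia; lia. }
  assert (HN : (rc Q - 2 + 2 * Z.of_nat N = rd Q)%Z).
  { unfold N; destruct Ec as [a Ec], Ed as [b Ed].
    replace (rd Q - (rc Q - 2))%Z with ((b - a + 1) * 2)%Z by lia.
    rewrite Z.div_mul by lia; lia. }
  assert (HL : forall r, In r L <-> exists m n, (m <= M)%nat /\ (n <= N)%nat /\ r = val (m, n)).
  { intros r; unfold L; rewrite in_map_iff; split.
    - intros [[m n] [<- Hp]]; apply in_prod_iff in Hp; rewrite !in_seq in Hp.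
      exists m, n; repeat split; lia.
    - intros (m & n & Hm & Hn & ->); exists (m, n); split; [reflexivity|].
      apply in_prod_iff; rewrite !in_seq; lia. }
  assert (HLe : forall u v, Z.Even u -> Z.Even v -> In (H u v) L).
  { intros u v Eu Ev; rewrite (proj2 HH u v).
    assert (Ecl : forall lo hi z, Z.Even lo -> Z.Even hi -> Z.Even z -> Z.Even (clamp lo hi z)).
    { intros lo hi z ? ? ?; unfold clamp.
      destruct (Z.max_spec lo (Z.min hi z)) as [[_ ->]|[_ ->]]; [|assumption].
      destruct (Z.min_spec hi z) as [[_ ->]|[_ ->]]; assumption. }
    pose proof (clamp_range (ra Q - 2) (rb Q) u ltac:(lia)) as Ru.
    pose proof (clamp_range (rc Q - 2) (rd Q) v ltac:(lia)) as Rv.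
    destruct (even_offset (ra Q - 2) (clamp (ra Q - 2) (rb Q) u)) as [m Em];
      [apply even_sub2; auto|apply Ecl; auto using even_sub2|lia|].
    destruct (even_offset (rc Q - 2) (clamp (rc Q - 2) (rd Q) v)) as [n En];
      [apply even_sub2; auto|apply Ecl; auto using even_sub2|lia|].
    apply HL; exists m, n; rewrite Em, En in *; repeat split; try lia; reflexivity. }
  destruct (strict_sort L) as (vs & Hs & Evs).
  set (V := fun k => nth k vs 0).
  assert (Hne : (1 <= length vs)%nat).
  { destruct vs as [|r vs]; [|simpl; lia].
    exfalso; apply (proj2 (Evs (H (ra Q) (rc Q)))); auto. }
  (* The number of gaps between consecutive heights, one trace for each; the default of [nth] is not
     read at indices up to [n]. *)
  set (n := (length vs - 1)%nat).
  assert (HV : forall k, (k < n)%nat -> V k < V (S k))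
    by (intros k Hk; apply StronglySorted_nth_lt; [exact Hs|lia]).
  assert (Hval : forall u v, Z.Even u -> Z.Even v -> exists m, (m <= n)%nat /\ H u v = V m).
  { intros u v Eu Ev; pose proof (proj2 (Evs _) (HLe u v Eu Ev)) as Hin.
    destruct (In_nth vs _ 0 Hin) as (m & Hm & E); exists m; split; [lia|symmetry; exact E]. }
  (* The last clause marks an edge whose later face has height exactly [V (S k)]. A trace at a
     higher level cannot contain it, which makes the traces distinct. *)
  destruct (list_choice (A := trace) [] (fun k l => inC Q l /\ at_level H l (V (S k)) /\
    exists j, (j < tlen l)%nat /\ late H (tedge l j) = V (S k)) n) as (ls & Hlen & Hls).
  { intros k Hk.
    assert (Hin : In (V (S k)) L) by (apply Evs, nth_In; lia).
    apply HL in Hin; destruct Hin as (i & j & Hi & Hj & E).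
    destruct (value_edge Q H (i + j) i j HQ HH (le_n _)) as (e & He & E1 & E2); [lia|lia| |].
    { change (H (ra Q - 2)%Z (rc Q - 2)%Z < val (i, j)); rewrite <- E.
      (* [V k] is itself the height of a face, hence at least that of the earliest face. *)
      apply Rle_lt_trans with (V k); [|apply HV, Hk].
      assert (Hk0 : In (V k) L) by (apply Evs, nth_In; lia).
      apply HL in Hk0; destruct Hk0 as (i0 & j0 & Hi0 & Hj0 & ->).
      apply HH; cbn [fst snd]; lia. }
    change (H (ra Q - 2 + 2 * Z.of_nat i)%Z (rc Q - 2 + 2 * Z.of_nat j)%Z) with (val (i, j)) in E1, E2.
    rewrite <- E in E1, E2.
    destruct (extend_to_C Q H (V (S k)) (edge_trace e) HH) as (l & C & Lv & Hincl).
    - apply edge_trace_sub, He.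
    - apply edge_trace_level; lra.
    - exists l; split; [exact C|split; [exact Lv|]].
      assert (Hel : is_edge_of e l).
      { apply is_edge_of_In; [apply C|]; split; apply Hincl;
          unfold edge_trace; destruct (snd e); simpl; auto. }
      destruct Hel as [q [Hq ->]]; exists q; auto. }
  exists V, ls; constructor; rewrite ?Hlen; auto.
  - intros k Hk; apply Hls, Hk.
  - intros k Hk; apply Hls, Hk.
  - intros i j Hij E.
    destruct (Hls i ltac:(lia)) as (_ & _ & q & Hq & Eq).
    destruct (Hls j ltac:(lia)) as (_ & Lv & _).
    rewrite E in Hq, Eq; destruct (Lv q Hq) as [_ Hle].
    pose proof (strict_chain_lt V n (S i) (S j) HV ltac:(lia) ltac:(lia)); lra.
Qed.

(** * Uniqueness of the data *)

(** Each head is below its whole tail, so different heads would be below each other. Asymmetry is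
    asked for members only, since for [prec] it is known among crossings of the domain. *)
Lemma sorted_same_elements {A : Type} (lt : A -> A -> Prop) (l l' : list A) :
  (forall x y, In x l -> In y l -> lt x y -> lt y x -> False) ->
  StronglySorted lt l -> StronglySorted lt l' -> (forall x, In x l <-> In x l') -> l = l'.
Proof.
  intros Has Hs; revert l' Has; induction Hs as [|a r Hs IH Ha]; intros l' Has Hs' E.
  - destruct l' as [|b r']; [reflexivity|]; destruct (proj2 (E b)); left; reflexivity.
  - destruct Hs' as [|b r' Hs' Hb]; [destruct (proj1 (E a)); left; reflexivity|].
    rewrite Forall_forall in Ha, Hb.
    assert (Eab : a = b).
    { destruct (proj1 (E a)) as [Hba|Hba]; [left; reflexivity|auto|].
      destruct (proj2 (E b)) as [Hab|Hab]; [left; reflexivity|auto|].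
      exfalso; apply (Has a b); simpl; auto. }
    subst b; f_equal; apply IH; auto.
    + intros x y Hx Hy; apply Has; right; assumption.
    + intros x; split; intros Hx.
      * destruct (proj1 (E x)) as [<-|]; [right; exact Hx| |assumption].
        exfalso; apply (Has a a); simpl; auto.
      * destruct (proj2 (E x)) as [<-|]; [right; exact Hx| |assumption].
        exfalso; apply (Has a a); simpl; auto.
Qed.

Lemma nth_StronglySorted {A : Type} (d : A) (lt : A -> A -> Prop) (l : list A) :
  (forall i j, (i < j < length l)%nat -> lt (nth i l d) (nth j l d)) -> StronglySorted lt l.
Proof.
  induction l as [|a l IH]; intros Hl; constructor.
  - apply IH; intros i j Hij; apply (Hl (S i) (S j)); simpl; lia.
  - apply Forall_forall; intros x Hx; destruct (In_nth l x d Hx) as (j & Hj & <-).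
    apply (Hl 0%nat (S j)); simpl; lia.
Qed.

Lemma valid_charac_posC (Q : rect) (eta : edge -> R) (ls : list trace) (ws : list R) (l : trace) :
  valid_data Q ls ws -> charac Q eta ls ws -> (posC Q eta l <-> In l ls).
Proof.
  intros (Hlen & HC & _ & Hw) Hch; split.
  - intros [Hl Hpos]; destruct (excluded_middle_informative (In l ls)) as [|Hno]; [assumption|].
    rewrite (proj2 (Hch l Hl)) in Hpos; [lra|].
    intros j Hj ->; apply Hno, nth_In, Hj.
  - intros Hin; destruct (In_nth ls l [] Hin) as (j & Hj & <-).
    split; [apply HC, Hj|].
    rewrite (proj1 (Hch _ (HC j Hj)) j Hj eq_refl); apply Hw; lia.
Qed.

(** Data matching [eta] list exactly the crossings of positive weight, in increasing order, so the
    list is determined; the weights are then read off from [charac]. *)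
Lemma valid_charac_unique (Q : rect) (eta : edge -> R) (ls ls' : list trace) (ws ws' : list R) :
  even_rect Q -> valid_data Q ls ws -> charac Q eta ls ws ->
  valid_data Q ls' ws' -> charac Q eta ls' ws' -> ls' = ls /\ ws' = ws.
Proof.
  intros HQ Hv Hch Hv' Hch'.
  assert (E : ls' = ls).
  { apply (sorted_same_elements prec).
    - intros x y Hx Hy [H1 Hne] [H2 _].
      apply (valid_charac_posC Q eta ls' ws') in Hx, Hy; auto.
      apply Hne, (succeq_antisym Q); auto; [apply Hy|apply Hx].
    - apply (nth_StronglySorted []), Hv'.
    - apply (nth_StronglySorted []), Hv.
    - intros x; rewrite <- (valid_charac_posC Q eta ls ws), <- (valid_charac_posC Q eta ls' ws') by assumption.
      reflexivity. }
  subst ls'; split; [reflexivity|].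
  destruct Hv as (Hlen & HC & _), Hv' as (Hlen' & _).
  apply nth_ext with 0 0; [congruence|]; intros j Hj; rewrite Hlen' in Hj.
  rewrite <- (proj1 (Hch _ (HC j Hj)) j Hj eq_refl).
  rewrite <- (proj1 (Hch' _ (HC j Hj)) j Hj eq_refl); reflexivity.
Qed.

(** * Order and data of a level chain *)

Lemma chain_total (Q : rect) (eta : edge -> R) (H : Z -> Z -> R) (V : nat -> R)
  (ls : list trace) (l1 l2 : trace) :
  even_rect Q -> is_potential Q eta H -> level_chain Q H V ls ->
  posC Q eta l1 -> posC Q eta l2 -> succeq l1 l2 \/ succeq l2 l1.
Proof.
  intros HQ HP HC P1 P2.
  pose proof (proj1 P1) as C1; pose proof (proj1 P2) as C2.
  apply (chain_posC Q eta H V ls) in P1, P2; auto.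
  destruct (In_nth ls l1 [] P1) as (i & Hi & Ei), (In_nth ls l2 [] P2) as (j & Hj & Ej).
  pose proof (chain_level _ _ _ _ HC i Hi) as L1; rewrite Ei in L1.
  pose proof (chain_level _ _ _ _ HC j Hj) as L2; rewrite Ej in L2.
  destruct (Rle_dec (V (S i)) (V (S j))); [right|left];
    eapply (level_succeq Q H); eauto; try apply HP; lra.
Qed.

Lemma chain_valid (Q : rect) (eta : edge -> R) (H : Z -> Z -> R) (V : nat -> R) (ls : list trace) :
  even_rect Q -> is_potential Q eta H -> level_chain Q H V ls ->
  valid_data Q ls (map (weight eta) ls).
Proof.
  intros HQ HP HC; split; [apply length_map|split; [apply (chain_C _ _ _ _ HC)|split]].
  - intros i j Hij; split.
    + apply (level_succeq Q H (V (S i)) (V (S j))); auto; try apply HP;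
        try (apply (chain_C _ _ _ _ HC); lia); try (apply (chain_level _ _ _ _ HC); lia).
      apply Rlt_le, (strict_chain_lt V (length ls)); try lia; apply (chain_incr _ _ _ _ HC).
    + intros E; apply (chain_distinct _ _ _ _ HC i j Hij); congruence.
  - rewrite length_map; intros j Hj.
    rewrite (nth_indep _ 0 (weight eta [])) by (rewrite length_map; exact Hj).
    rewrite map_nth.
    apply (chain_posC Q eta H V ls); auto; apply nth_In, Hj.
Qed.

Lemma chain_charac_weights (Q : rect) (eta : edge -> R) (H : Z -> Z -> R) (V : nat -> R) (ls : list trace) :
  even_rect Q -> is_potential Q eta H -> level_chain Q H V ls ->
  charac Q eta ls (map (weight eta) ls).
Proof.
  intros HQ HP HC; apply (chain_charac Q eta H V); auto; intros j Hj.
  rewrite (nth_indep _ 0 (weight eta [])) by (rewrite length_map; exact Hj).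
  rewrite map_nth; apply (chain_weight Q eta H V); assumption.
Qed.

Theorem mainTheorem9 (S : rect)
  (Ha : Z.Even (ra S)) (Hb : Z.Even (rb S)) (Hc : Z.Even (rc S)) (Hd : Z.Even (rd S))
  (Hab : (ra S <= rb S)%Z) (Hcd : (rc S <= rd S)%Z) :
  (* (a) *)
  (forall (ls : list trace) (ws : list R), valid_data S ls ws ->
     exists eta, is_flow S eta /\ charac S eta ls ws /\
       (forall eta', is_flow S eta' -> charac S eta' ls ws ->
          forall e, inE S e -> eta' e = eta e))
  /\
  (* (b) *)
  (forall eta, is_flow S eta ->
     (forall l, posC S eta l -> succeq l l) /\
     (forall l1 l2, posC S eta l1 -> posC S eta l2 -> succeq l1 l2 \/ succeq l2 l1) /\
     (forall l1 l2, posC S eta l1 -> posC S eta l2 -> succeq l1 l2 -> succeq l2 l1 -> l1 = l2) /\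
     (forall l1 l2 l3, posC S eta l1 -> posC S eta l2 -> posC S eta l3 ->
        succeq l1 l2 -> succeq l2 l3 -> succeq l1 l3) /\
     exists ls : list trace,
       (forall l, posC S eta l <-> In l ls) /\
       valid_data S ls (map (weight eta) ls) /\
       charac S eta ls (map (weight eta) ls) /\
       (forall ls' ws', valid_data S ls' ws' -> charac S eta ls' ws' ->
          ls' = ls /\ ws' = map (weight eta) ls) /\
       (forall e, inE S e ->
          eta e = wsum ls (map (weight eta) ls) (fun l => indic (is_edge_of e l))) /\
       (forall y, inS S y ->
          birth eta y = wsum ls (map (weight eta) ls) (fun l => indic (is_left_corner l y))) /\
       (forall y, inS S y -> inBd S ((tc y - 1)%Z, (xc y - 1)%Z) ->
          zeta_plus eta y = wsum ls (map (weight eta) ls) (fun l => indic (zplus_tr S l y))) /\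
       (forall y, inS S y -> inBd S ((tc y - 1)%Z, (xc y + 1)%Z) ->
          zeta_minus eta y = wsum ls (map (weight eta) ls) (fun l => indic (zminus_tr S l y))) /\
       (forall l, sub_Sbar S l ->
          weight eta l = wsum ls (map (weight eta) ls) (fun l' => indic (subtrace l l')))).
Proof.
  assert (HQ : even_rect S) by (unfold even_rect; tauto).
  split.
  - intros ls ws Hv.
    set (H := chain_height S ls ws).
    pose proof (chain_height_is_height S ls ws Hv) as HH; fold H in HH.
    pose proof (chain_height_chain S ls ws HQ Hv) as HC; fold H in HC.
    (* Uniqueness in (a): the level chain of any matching flow field carries the data [ls], [ws], so
       the edge decomposition expresses the field through these data alone. *)
    assert (Hwt : forall eta, is_flow S eta -> charac S eta ls ws -> forall e, inE S e ->
      eta e = wsum ls ws (fun l => indic (is_edge_of e l))).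
    { intros eta Hf Hch e He.
      pose proof (flow_potential S eta HQ Hf) as HP.
      destruct (height_chain S _ HQ (proj1 HP)) as (V & ls1 & HC1).
      destruct (valid_charac_unique S eta ls ls1 ws (map (weight eta) ls1) HQ Hv Hch) as [<- <-].
      - apply (chain_valid S eta (flow_height S eta) V); eassumption.
      - apply (chain_charac_weights S eta (flow_height S eta) V); eassumption.
      - apply (flow_decomposition S eta (flow_height S eta) V ls1 e HQ HP HC1 He), Hf, He. }
    assert (Hch : charac S (height_flow H) ls ws).
    { apply (chain_charac S (height_flow H) H (psum (fun j => nth j ws 0))); auto.
      - split; [exact HH|reflexivity].
      - intros j _; simpl; ring. }
    pose proof (height_flow_is_flow S H HH) as Hf.
    exists (height_flow H); split; [exact Hf|split; [exact Hch|]].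
    intros eta' Hf' Hch' e He.
    rewrite (Hwt eta' Hf' Hch' e He), (Hwt _ Hf Hch e He); reflexivity.
  - intros eta Hf.
    pose proof (flow_potential S eta HQ Hf) as HP.
    destruct (height_chain S _ HQ (proj1 HP)) as (V & ls & HC).
    pose proof (chain_valid S eta (flow_height S eta) V ls HQ HP HC) as Hv.
    pose proof (chain_charac_weights S eta (flow_height S eta) V ls HQ HP HC) as Hch.
    pose proof (fun l => chain_posC S eta (flow_height S eta) V ls l HQ HP HC) as Hpos.
    pose proof (fun l1 l2 => chain_total S eta (flow_height S eta) V ls l1 l2 HQ HP HC) as Htot.
    assert (Hedge : forall e, inE S e ->
      eta e = wsum ls (map (weight eta) ls) (fun l => indic (is_edge_of e l)))
      by (intros e He; apply (flow_decomposition S eta (flow_height S eta) V ls e HQ HP HC He), Hf, He).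
    split; [intros l Hl; destruct (Htot l l Hl Hl); assumption|].
    split; [exact Htot|].
    split; [intros l1 l2 [C1 _] [C2 _]; apply (succeq_antisym S); assumption|].
    split.
    { intros l1 l2 l3 P1 P2 P3; apply (succeq_trans_total S); auto; [apply P1|apply P2|apply P3]. }
    exists ls; split; [exact Hpos|split; [exact Hv|split; [exact Hch|]]].
    split; [intros ls' ws'; apply (valid_charac_unique S eta); assumption|].
    split; [exact Hedge|split; [|split; [|split]]].
    + intros y Hy; apply (birth_decomposition S eta (flow_height S eta) V ls y HQ HP HC Hy).
      destruct (star_inE S y Hy) as (_ & E1 & _ & E2).
      apply Rmin_glb; apply Hf; assumption.
    + intros y Hy Hbd; unfold zeta_plus; rewrite Hedge by apply (star_inE S y Hy).
      apply wsum_ext; intros l Hl; apply Hpos in Hl; apply indic_iff, zeta_plus_edge; auto; apply Hl.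
    + intros y Hy Hbd; unfold zeta_minus; rewrite Hedge by apply (star_inE S y Hy).
      apply wsum_ext; intros l Hl; apply Hpos in Hl; apply indic_iff, zeta_minus_edge; auto; apply Hl.
    + intros l; apply (chain_weight_formula S eta (flow_height S eta) V ls l HQ HP HC).
Qed.
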